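(* There is a (non-empty) subset $\Lambda\subset\Omega=\{0,1,2\}^{\mathbb N}$ such that the universal group $U_\Lambda$ of the family $\{(G_\omega,S_\omega)\mid\omega\in\Lambda\}$ has intermediate growth and has $2^{\aleph_0}$ distinct continuous ergodic invariant random subgroups.
   Context: Groups $G_\omega$. Let $\Omega=\{0,1,2\}^{\mathbb N}$ be the set of infinite sequences $\omega=\omega_1\omega_2\ldots$ with $\omega_i\in\{0,1,2\}$, and let $\tau$ be the shift, $\tau\omega=\omega_2\omega_3\ldots$. Let $T_2$ be the binary rooted tree with vertex set $\{0,1\}^*$ (edges join $w$ to $wx$, $x\in\{0,1\}$). For $\omega\in\Omega$ define automorphisms $a,b_\omega,c_\omega,d_\omega$ of $T_2$ recursively by: $a(0v)=1v$, $a(1v)=0v$; $b_\omega(0v)=0\,\beta(\omega_1)(v)$, $b_\omega(1v)=1\,b_{\tau\omega}(v)$; $c_\omega(0v)=0\,\zeta(\omega_1)(v)$, $c_\omega(1v)=1\,c_{\tau\omega}(v)$; $d_\omega(0v)=0\,\delta(\omega_1)(v)$, $d_\omega(1v)=1\,d_{\tau\omega}(v)$ for all $v\in\{0,1\}^*$, where $\beta(0)=\beta(1)=a$, $\beta(2)=e$; $\zeta(0)=\zeta(2)=a$, $\zeta(1)=e$; $\delta(1)=\delta(2)=a$, $\delta(0)=e$, and $e$ is the identity automorphism. Let $S_\omega=(a,b_\omega,c_\omega,d_\omega)$ and $G_\omega=\langle S_\omega\rangle\le \mathrm{Aut}(T_2)$. Universal groups. Let $F_4$ be free with basis $x_1,\dots,x_4$,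 and let $N_\omega$ be the kernel of the homomorphism $F_4\to G_\omega$ sending $x_1,x_2,x_3,x_4$ to $a,b_\omega,c_\omega,d_\omega$ respectively. For non-empty $\Lambda\subset\Omega$, $U_\Lambda=F_4/\bigcap_{\omega\in\Lambda}N_\omega$. Growth. For a group $G$ with finite generating set $S$, $\gamma_{G,S}(n)$ is the number of elements of $G$ of word length at most $n$ with respect to $S$. For increasing functions $f_1,f_2$ on the natural numbers, $f_1\preceq f_2$ means that there is $C>0$ with $f_1(n)\le f_2(Cn)$ for all $n$, and $f_1\sim f_2$ means $f_1\preceq f_2$ and $f_2\preceq f_1$. The group $G$ has polynomial growth if $\gamma_G\preceq n^d$ for some $d\ge 0$, exponential growth if $\gamma_G\sim e^n$, and intermediate growth if neither holds. Invariant random subgroups. For a countable group $G$, $S(G)$ is the space of all subgroups of $G$ with the topology induced from the product topology on $\{0,1\}^G$; $G$ acts on $S(G)$ by conjugation. An invariant random subgroup of $G$ is a conjugation-invariant Borel probability measure on $S(G)$. It is continuous if it has no atoms, and ergodic if every conjugation-invariant Borel set has measure $0$ or $1$. *)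

(* Defs.v *)
From HB Require Import structures.
From mathcomp Require Import all_boot all_order all_algebra.
From mathcomp Require Import generic_quotient finmap.
From mathcomp Require Import all_classical all_reals all_analysis.

Set Implicit Arguments.
Unset Strict Implicit.
Unset Printing Implicit Defensive.

Import Order.TTheory GRing.Theory Num.Theory.

Local Open Scope classical_set_scope.
Local Open Scope group_scope.

Record normal_subgroup (G : groupType) := NormalSubgroup {
  nsub_mem :> {pred G};
  nsub_closed : group_closed nsub_mem;
  nsub_conj : forall x y, x \in nsub_mem -> x ^ y \in nsub_mem }.

Section Kernel.
Variables (G H : groupType) (f : UMagmaMorphism.type G H).

Definition kernel_pred : {pred G} := [pred x | f x == 1].

Fact kernel_closed : group_closed kernel_pred.
Proof.
split=> [|x y]; rewrite !inE ?gmulf1// => /eqP fx /eqP fy.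
by rewrite gmulfM gmulfV fx fy invg1 mulg1.
Qed.

Fact kernel_conj x y : x \in kernel_pred -> x ^ y \in kernel_pred.
Proof.
rewrite !inE => /eqP fx.
by rewrite conjgE !gmulfM fx mul1g gmulfV mulVg.
Qed.

Definition nsub_kernel := NormalSubgroup kernel_closed kernel_conj.
End Kernel.

Section Intersection.
Variables (G : groupType) (I : Type) (D : set I) (N : I -> normal_subgroup G).

Definition nsub_bigcap_pred : {pred G} :=
  [pred x | `[< forall i, D i -> x \in N i >]].

Fact nsub_bigcap_closed : group_closed nsub_bigcap_pred.
Proof.
split=> [|x y]; rewrite !inE.
  by move=> i _; case: (nsub_closed (N i)).
move=> Nx Ny i Di.
by case: (nsub_closed (N i)) => _; apply; [exact: Nx|exact: Ny].
Qed.

Fact nsub_bigcap_conj x y :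
  x \in nsub_bigcap_pred -> x ^ y \in nsub_bigcap_pred.
Proof.
by rewrite !inE => Nx i Di; exact/nsub_conj/Nx.
Qed.

Definition nsub_bigcap :=
  NormalSubgroup nsub_bigcap_closed nsub_bigcap_conj.
End Intersection.

Section Quotient.
Variables (G : groupType) (N : normal_subgroup G).

Definition nsub_rel : rel G := fun x y => x^-1 * y \in N.

Let N1 : 1 \in N. Proof. by case: (nsub_closed N). Qed.
Let NM : {in N &, forall x y, x * y \in N}.
Proof. exact: group_closedM (nsub_closed N). Qed.
Let NV : {in N, forall x, x^-1 \in N}.
Proof. exact: group_closedV (nsub_closed N). Qed.

Fact nsub_refl : reflexive nsub_rel.
Proof. by move=> x; rewrite /nsub_rel mulVg. Qed.
Fact nsub_sym : symmetric nsub_rel.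
Proof.
suff h x y : nsub_rel x y -> nsub_rel y x by move=> x y; apply/idP/idP => /h.
by rewrite /nsub_rel => /NV; rewrite invgM invgK.
Qed.
Fact nsub_trans : transitive nsub_rel.
Proof.
move=> y x z xy yz; have := NM xy yz.
by rewrite mulgA -(mulgA x^-1) mulgV mulg1.
Qed.

Canonical nsub_equiv := EquivRel nsub_rel nsub_refl nsub_sym nsub_trans.

Definition quotient_group := {eq_quot nsub_equiv}%qT.

HB.instance Definition _ := Choice.on quotient_group.
HB.instance Definition _ := EqQuotient.on quotient_group.

Definition quot_proj (x : G) : quotient_group := (\pi_quotient_group x)%qT.

Let projP x y : reflect (quot_proj x = quot_proj y) (x^-1 * y \in N).
Proof. exact: (iffP (eqmodP nsub_equiv x y)). Qed.

Let reprK (q : quotient_group) : quot_proj (repr q) = q.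
Proof. exact: reprK. Qed.

Definition quot_mul (p q : quotient_group) := quot_proj (repr p * repr q).
Definition quot_inv (p : quotient_group) := quot_proj (repr p)^-1.

Fact quot_mulE x y : quot_mul (quot_proj x) (quot_proj y) = quot_proj (x * y).
Proof.
have /projP Nx := reprK (quot_proj x); have /projP Ny := reprK (quot_proj y).
apply/projP; rewrite invgM.
set x' := repr _ in Nx *; set y' := repr _ in Ny *.
have -> : y'^-1 * x'^-1 * (x * y) = y'^-1 * y * (x'^-1 * x) ^ y.
  by rewrite conjgE !mulgA -(mulgA y'^-1 y) mulgV mulg1.
by apply: NM => //; exact: nsub_conj.
Qed.

Fact quot_invE x : quot_inv (quot_proj x) = quot_proj x^-1.
Proof.
have /projP Nx := reprK (quot_proj x); apply/projP; rewrite invgK.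
set x' := repr _ in Nx *.
have -> : x' * x^-1 = ((x'^-1 * x)^-1) ^ x^-1.
  by rewrite conjgE invgK invgM invgK !mulgA mulgV mul1g.
exact/nsub_conj/NV.
Qed.

Fact quot_mulA : associative quot_mul.
Proof.
move=> p q r; rewrite -(reprK p) -(reprK q) -(reprK r).
by rewrite !quot_mulE mulgA.
Qed.
Fact quot_mul1 : left_id (quot_proj 1) quot_mul.
Proof. by move=> p; rewrite -(reprK p) quot_mulE mul1g. Qed.
Fact quot_1mul : right_id (quot_proj 1) quot_mul.
Proof. by move=> p; rewrite -(reprK p) quot_mulE mulg1. Qed.
Fact quot_mulV : left_inverse (quot_proj 1) quot_inv quot_mul.
Proof. by move=> p; rewrite -(reprK p) quot_invE quot_mulE mulVg. Qed.
Fact quot_Vmul : right_inverse (quot_proj 1) quot_inv quot_mul.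
Proof. by move=> p; rewrite -(reprK p) quot_invE quot_mulE mulgV. Qed.

HB.instance Definition _ := isGroup.Build quotient_group
  quot_mulA quot_mul1 quot_1mul quot_mulV quot_Vmul.

Fact quot_proj_morphism : monoid.monoid_morphism quot_proj.
Proof. by split=> // x y; rewrite -quot_mulE. Qed.
HB.instance Definition _ :=
  isUMagmaMorphism.Build G quotient_group quot_proj quot_proj_morphism.

Lemma quot_proj_eq1 x : (quot_proj x == 1) = (x \in N).
Proof.
apply/eqP/idP => [/esym/projP|Nx]; first by rewrite invg1 mul1g.
by apply/esym/projP; rewrite invg1 mul1g.
Qed.
End Quotient.

Section FreeGroup.
Variable X : choiceType.

(* Elements of the free group are reduced words; (x, false) stands for x and
   (x, true) for x^-1. *)
Definition letter : Type := X * bool.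
HB.instance Definition _ := Choice.on letter.
Definition letter_inv (l : letter) : letter := (l.1, ~~ l.2).

Definition reduced (w : seq letter) := sorted (fun k l => l != letter_inv k) w.

Record free_group := FreeGroup { fg_word :> seq letter; _ : reduced fg_word }.
HB.instance Definition _ := [isSub for fg_word].
HB.instance Definition _ := [Choice of free_group by <:].

(* The reduced form of the word l :: w, when w is reduced. *)
Definition push (l : letter) (w : seq letter) : seq letter :=
  if w is k :: w' then if k == letter_inv l then w' else l :: w else [:: l].

Definition fg_mul_word (u v : seq letter) : seq letter := foldr push v u.
Definition fg_inv_word (w : seq letter) : seq letter :=
  rev (map letter_inv w).

Fact letter_invK : involutive letter_inv.
Proof. by case=> x b; rewrite /letter_inv /= negbK. Qed.

Fact reduced_push l w : reduced w -> reduced (push l w).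
Proof.
rewrite /reduced; case: w => //= k w kw; case: ifPn => [_|nkl] /=.
  exact: path_sorted kw.
by rewrite nkl kw.
Qed.

Fact push_inv l w : reduced w -> push l (push (letter_inv l) w) = w.
Proof.
rewrite /reduced; case: w => [_ /=|k w /=]; first by rewrite eqxx.
rewrite letter_invK; case: eqP => [-> lw|_ _ /=]; last by rewrite eqxx.
by case: w lw => //= k' w /andP[/negPf -> _].
Qed.

Fact reduced_mul u v : reduced v -> reduced (fg_mul_word u v).
Proof. by move=> rv; elim: u => //= l u; exact: reduced_push. Qed.

Fact fg_mul_wordA u v w : reduced u -> reduced v -> reduced w ->
  fg_mul_word u (fg_mul_word v w) = fg_mul_word (fg_mul_word u v) w.
Proof.
move=> _ rv rw; elim: u => //= l u ->.
have: reduced (fg_mul_word u v) by exact: reduced_mul.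
case: (fg_mul_word u v) => //= k t _; case: eqP => //= ->.
by rewrite push_inv//; exact: reduced_mul.
Qed.

Fact fg_mul_word0 u : reduced u -> fg_mul_word u [::] = u.
Proof.
rewrite /reduced /fg_mul_word; elim: u => //= l [|k u] IHu //= /andP[kl ku].
by rewrite [push k _]IHu //= (negPf kl).
Qed.

Fact fg_mul_word_cat u v w :
  fg_mul_word (u ++ v) w = fg_mul_word u (fg_mul_word v w).
Proof. exact: foldr_cat. Qed.

Fact reduced_inv w : reduced w -> reduced (fg_inv_word w).
Proof.
rewrite /reduced /fg_inv_word rev_sorted sorted_map; apply: sub_sorted.
by move=> k l /=; rewrite letter_invK eq_sym.
Qed.

Fact fg_inv_wordK : involutive fg_inv_word.
Proof.
by move=> w; rewrite /fg_inv_word map_rev revK mapK//; exact: letter_invK.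
Qed.

Fact fg_mul_wordV u w : reduced w ->
  fg_mul_word u (fg_mul_word (fg_inv_word u) w) = w.
Proof.
elim: u w => [|l u IHu] w rw //=.
rewrite /fg_inv_word /= rev_cons -cats1 fg_mul_word_cat /= IHu.
  exact: push_inv.
exact: reduced_push.
Qed.

Definition fg_one := @FreeGroup [::] isT.
Definition fg_mul (u v : free_group) :=
  FreeGroup (reduced_mul u (valP v)).
Definition fg_inv (u : free_group) := FreeGroup (reduced_inv (valP u)).

Fact fg_mulA : associative fg_mul.
Proof. by move=> u v w; apply/val_inj/fg_mul_wordA; apply: valP. Qed.
Fact fg_mul1 : left_id fg_one fg_mul.
Proof. by move=> u; apply: val_inj. Qed.
Fact fg_1mul : right_id fg_one fg_mul.
Proof. by move=> u; apply/val_inj/fg_mul_word0/valP. Qed.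
Fact fg_Vmul : right_inverse fg_one fg_inv fg_mul.
Proof.
move=> u; apply: val_inj => /=.
by rewrite -[fg_inv_word _]fg_mul_word0 ?fg_mul_wordV//; exact/reduced_inv/valP.
Qed.
Fact fg_mulV : left_inverse fg_one fg_inv fg_mul.
Proof.
move=> u; have := fg_Vmul (fg_inv u).
by have -> : fg_inv (fg_inv u) = u by apply/val_inj/fg_inv_wordK.
Qed.

HB.instance Definition _ :=
  isGroup.Build free_group fg_mulA fg_mul1 fg_1mul fg_mulV fg_Vmul.

Definition fg_gen (x : X) : free_group := @FreeGroup [:: (x, false)] isT.
End FreeGroup.

Definition eval_word (X : Type) (G : groupType) (S : X -> G)
    (w : seq (X * bool)) : G :=
  \prod_(l <- w) (if l.2 then (S l.1)^-1 else S l.1).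

Section FreeGroupLift.
Variables (X : choiceType) (G : groupType) (S : X -> G).

Definition fg_lift (u : free_group X) : G := eval_word S u.

Fact eval_push (l : letter X) w :
  eval_word S (push l w) = eval_word S [:: l] * eval_word S w.
Proof.
rewrite /eval_word big_seq1; case: w => [|k w] /=.
  by rewrite big_seq1 big_nil mulg1.
case: eqP => [->|_]; rewrite !big_cons//= mulgA.
by case: l.2 => /=; rewrite ?mulVg ?mulgV mul1g.
Qed.

Fact fg_lift_morphism : monoid.monoid_morphism fg_lift.
Proof.
split; first exact: big_nil.
move=> u v; rewrite /fg_lift /= /fg_mul_word.
elim: (fg_word u) => [|l w IHw] /=; first by rewrite /eval_word big_nil mul1g.
by rewrite eval_push IHw mulgA -/(eval_word S (l :: w)) /eval_word big_seq1
  big_cons.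
Qed.
HB.instance Definition _ :=
  isUMagmaMorphism.Build (free_group X) G fg_lift fg_lift_morphism.

Lemma fg_lift_gen x : fg_lift (fg_gen x) = S x.
Proof. by rewrite /fg_lift /eval_word big_seq1. Qed.

Lemma fg_lift_unique (f : UMagmaMorphism.type (free_group X) G) :
  (forall x, f (fg_gen x) = S x) -> f =1 fg_lift.
Proof.
move=> fS [w rw]; elim: w rw => [|[x b] w IHw] rw.
  by rewrite (_ : FreeGroup rw = 1) ?gmulf1//; exact: val_inj.
have rw' : reduced w by exact: path_sorted rw.
pose g : free_group X := if b then (fg_gen x)^-1 else fg_gen x.
have -> : FreeGroup rw = g * FreeGroup rw'.
  apply: val_inj; rewrite /= /g; case: b rw {g} => rw /=.
    by case: w rw rw' {IHw} => //= k w /andP[/negPf ->].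
  by case: w rw rw' {IHw} => //= k w /andP[/negPf ->].
have fgE : f g = fg_lift g.
  by rewrite /g; case: (b); rewrite ?gmulfV fS -fg_lift_gen.
by rewrite !gmulfM IHw fgE.
Qed.
End FreeGroupLift.

Definition vertex := seq bool.

Definition tree_adjacent (v w : vertex) : Prop :=
  exists x, w = rcons v x \/ v = rcons w x.

Definition tree_automorphism (f : vertex -> vertex) : Prop :=
  [/\ bijective f, f [::] = [::] &
      forall v w, tree_adjacent (f v) (f w) <-> tree_adjacent v w].

Record autT2 := AutT2 {
  aut_fun :> vertex -> vertex;
  _ : `[< tree_automorphism aut_fun >] }.
HB.instance Definition _ := [isSub for aut_fun].
HB.instance Definition _ := [Choice of autT2 by <:].

Lemma autP (f : autT2) : tree_automorphism f.
Proof. by apply/asboolP; exact: valP f. Qed.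

Lemma aut_inverse (f : autT2) :
  exists g, tree_automorphism g /\ (cancel f g /\ cancel g f).
Proof.
have [[g fK gK] f0 adjf] := autP f; exists g; split=> //; split.
- by exists f.
- by rewrite -f0 fK.
- by move=> v w; rewrite -adjf !gK.
Qed.

Definition aut_inv_fun (f : autT2) : vertex -> vertex :=
  projT1 (cid (aut_inverse f)).

Fact aut_inv_funP (f : autT2) : tree_automorphism (aut_inv_fun f) /\
  (cancel f (aut_inv_fun f) /\ cancel (aut_inv_fun f) f).
Proof. by rewrite /aut_inv_fun; case: cid. Qed.

Fact aut_inv_proof (f : autT2) : `[< tree_automorphism (aut_inv_fun f) >].
Proof. by apply/asboolP; case: (aut_inv_funP f). Qed.

Fact aut_one_proof : `[< tree_automorphism id >].
Proof. by apply/asboolP; split=> //; exists id. Qed.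

Fact aut_mul_proof (f g : autT2) : `[< tree_automorphism (f \o g) >].
Proof.
have [bf f0 af] := autP f; have [bg g0 ag] := autP g.
apply/asboolP; split=> [||v w]; first exact: bij_comp.
- by rewrite /= g0.
- by rewrite /= af.
Qed.

Definition aut_one := AutT2 aut_one_proof.
Definition aut_inv (f : autT2) := AutT2 (aut_inv_proof f).
Definition aut_mul (f g : autT2) := AutT2 (aut_mul_proof f g).

Fact aut_mulA : associative aut_mul.
Proof. by move=> f g h; apply: val_inj. Qed.
Fact aut_mul1 : left_id aut_one aut_mul.
Proof. by move=> f; apply: val_inj. Qed.
Fact aut_1mul : right_id aut_one aut_mul.
Proof. by move=> f; apply: val_inj. Qed.
Fact aut_mulV : left_inverse aut_one aut_inv aut_mul.
Proof.
move=> f; apply: val_inj; apply/funext => v /=.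
by have [_ [fK _]] := aut_inv_funP f.
Qed.
Fact aut_Vmul : right_inverse aut_one aut_inv aut_mul.
Proof.
move=> f; apply: val_inj; apply/funext => v /=.
by have [_ [_ fK]] := aut_inv_funP f.
Qed.

HB.instance Definition _ :=
  isGroup.Build autT2 aut_mulA aut_mul1 aut_1mul aut_mulV aut_Vmul.

(* Indices start at 0: omega n is the term usually written omega_(n+1). *)
Definition Omega := nat -> 'I_3.
Definition shift (omega : Omega) : Omega := fun n => omega n.+1.

Definition a_fun (v : vertex) : vertex :=
  if v is x :: v' then ~~ x :: v' else [::].

(* The letters 0 and 1 of {0,1} are false and true. *)
Fixpoint rec_fun (p : 'I_3 -> vertex -> vertex) (omega : Omega) (v : vertex) :
    vertex :=
  match v with
  | [::] => [::]
  | false :: v' => false :: p (omega 0) v'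
  | true :: v' => true :: rec_fun p (shift omega) v'
  end.

Definition beta_fun (i : 'I_3) : vertex -> vertex :=
  if val i == 2%N then id else a_fun.
Definition zeta_fun (i : 'I_3) : vertex -> vertex :=
  if val i == 1%N then id else a_fun.
Definition delta_fun (i : 'I_3) : vertex -> vertex :=
  if val i == 0%N then id else a_fun.

Definition prefix_preserving (f : vertex -> vertex) : Prop :=
  f [::] = [::] /\ forall v x, exists y, f (rcons v x) = rcons (f v) y.

Lemma involution_automorphism (f : vertex -> vertex) :
  involutive f -> prefix_preserving f -> tree_automorphism f.
Proof.
move=> fK [f0 fr]; split=> //; first by exists f.
have h v w : tree_adjacent v w -> tree_adjacent (f v) (f w).
  by case=> x [->|->]; [have [y ->] := fr v x|have [y ->] := fr w x];
    exists y; [left|right].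
by move=> v w; split=> [/h|/h]; rewrite ?fK.
Qed.

Lemma a_fun_involutive : involutive a_fun.
Proof. by case=> //= x v; rewrite negbK. Qed.

Lemma a_fun_prefix : prefix_preserving a_fun.
Proof. by split=> // -[|x v] y; [exists (~~ y)|exists y]. Qed.

Lemma id_prefix : prefix_preserving id.
Proof. by split=> // v x; exists x. Qed.

Section RecFun.
Variable p : 'I_3 -> vertex -> vertex.

Lemma rec_fun_involutive :
  (forall i, involutive (p i)) -> forall omega, involutive (rec_fun p omega).
Proof.
by move=> pK omega v; elim: v omega => [|[] v IHv] omega //=;
  rewrite ?IHv ?pK.
Qed.

Lemma rec_fun_prefix : (forall i, prefix_preserving (p i)) ->
  forall omega, prefix_preserving (rec_fun p omega).
Proof.
move=> pp omega; split=> // v; elim: v omega => [|[] v IHv] omega x /=.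
- by case: x; [exists true|exists false; case: (pp (omega 0)) => ->].
- by have [y ->] := IHv (shift omega) x; exists y.
- by have [_ /(_ v x)[y ->]] := pp (omega 0); exists y.
Qed.

Lemma rec_fun_automorphism omega :
    (forall i, p i = id \/ p i = a_fun) ->
  `[< tree_automorphism (rec_fun p omega) >].
Proof.
move=> pE; apply/asboolP/involution_automorphism.
  apply: rec_fun_involutive => i.
  by case: (pE i) => ->; [|exact: a_fun_involutive].
apply: rec_fun_prefix => i.
by case: (pE i) => ->; [exact: id_prefix|exact: a_fun_prefix].
Qed.
End RecFun.

Fact a_proof : `[< tree_automorphism a_fun >].
Proof.
apply/asboolP/involution_automorphism; first exact: a_fun_involutive.
exact: a_fun_prefix.
Qed.
Fact b_proof omega : `[< tree_automorphism (rec_fun beta_fun omega) >].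
Proof.
by apply: rec_fun_automorphism => i; rewrite /beta_fun; case: ifP; [left|right].
Qed.
Fact c_proof omega : `[< tree_automorphism (rec_fun zeta_fun omega) >].
Proof.
by apply: rec_fun_automorphism => i; rewrite /zeta_fun; case: ifP; [left|right].
Qed.
Fact d_proof omega : `[< tree_automorphism (rec_fun delta_fun omega) >].
Proof.
by apply: rec_fun_automorphism => i; rewrite /delta_fun; case: ifP; [left|right].
Qed.

Definition a_ : autT2 := AutT2 a_proof.
Definition b_ (omega : Omega) : autT2 := AutT2 (b_proof omega).
Definition c_ (omega : Omega) : autT2 := AutT2 (c_proof omega).
Definition d_ (omega : Omega) : autT2 := AutT2 (d_proof omega).

Definition S_ (omega : Omega) (i : 'I_4) : autT2 :=
  tnth [tuple a_; b_ omega; c_ omega; d_ omega] i.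

Definition F4 : groupType := free_group 'I_4.

(* G_omega is the image of fg_lift (S_ omega), so this is also the kernel of
   the corestriction F4 -> G_omega. *)
Definition N_ (omega : Omega) : normal_subgroup F4 :=
  nsub_kernel (fg_lift (S_ omega)).

Definition U_ (Lambda : set Omega) : groupType :=
  quotient_group (nsub_bigcap Lambda N_).

Definition U_gen (Lambda : set Omega) (i : 'I_4) : U_ Lambda :=
  quot_proj (nsub_bigcap Lambda N_) (fg_gen i).

Section WordGrowth.
Variables (G : groupType) (k : nat) (S : 'I_k -> G).

Definition word_ball (n : nat) : set G :=
  [set g | exists2 w : seq ('I_k * bool), (size w <= n)%N & eval_word S w = g].

Lemma finite_word_ball n : finite_set (word_ball n).
Proof.
pose F (m : 'I_n.+1) : set G :=
  [set eval_word S (t : m.-tuple ('I_k * bool)) | t in [set: _]].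
apply: (@sub_finite_set _ _ (\bigcup_(m in [set: 'I_n.+1]) F m)).
  move=> g [w wn <-]; have wn' : (size w < n.+1)%N by [].
  by exists (Ordinal wn') => //; exists (in_tuple w).
by apply: bigcup_finite => [|m _]; [|apply: finite_image]; exact: finite_finset.
Qed.

Definition growth (n : nat) : nat := #|` fset_set (word_ball n)|%fset.
End WordGrowth.

Section GrowthTypes.
Variable R : realType.
Local Open Scope ring_scope.

(* The natural numbers are {1, 2, ...} here: with n = 0 allowed, no growth
   function would be dominated by n ^ d for d > 0, since its value at 0 is 1. *)
Definition growth_le (f1 f2 : nat -> R) : Prop :=
  exists2 C : nat, (0 < C)%N & forall n, (0 < n)%N -> f1 n <= f2 (C * n)%N.

Definition growth_equiv (f1 f2 : nat -> R) : Prop :=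
  growth_le f1 f2 /\ growth_le f2 f1.

Section OfGroup.
Variables (G : groupType) (k : nat) (S : 'I_k -> G).
Let gamma (n : nat) : R := (growth S n)%:R.

Definition polynomial_growth : Prop :=
  exists2 d : R, 0 <= d & growth_le gamma (fun n => n%:R `^ d).

Definition exponential_growth : Prop :=
  growth_equiv gamma (fun n => expR n%:R).

Definition intermediate_growth : Prop :=
  ~ polynomial_growth /\ ~ exponential_growth.
End OfGroup.
End GrowthTypes.

Section SubgroupSpace.
Variable G : groupType.

(* Subgroups are identified with their indicator functions; the topology on
   this set_type is the one induced by the product topology. *)
Definition subgroups : Type :=
  set_type [set H : {ptws G -> bool} | group_closed (H : {pred G})].

HB.instance Definition _ := Topological.on subgroups.

Fact trivial_subgroup_closed :
  [set H : {ptws G -> bool} | group_closed (H : {pred G})]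
    (fun x : G => x == 1).
Proof.
split; rewrite ?unfold_in// => x y.
by rewrite !unfold_in => /eqP -> /eqP ->; rewrite mulgV.
Qed.
HB.instance Definition _ :=
  isPointed.Build subgroups (SigSub (mem_set trivial_subgroup_closed)).

(* g H g^-1, since x ^ g = g^-1 * x * g. *)
Definition conj_fun (g : G) (H : subgroups) : {ptws G -> bool} :=
  fun x => set_val H (x ^ g).

Fact conj_closed g H :
  [set H : {ptws G -> bool} | group_closed (H : {pred G})] (conj_fun g H).
Proof.
have /set_mem[/= H1 HF] := valP H.
split=> [|x y]; rewrite !unfold_in /conj_fun; first by rewrite conj1g.
by rewrite conjMg conjVg; exact: HF.
Qed.

Definition conj_subgroup (g : G) (H : subgroups) : subgroups :=
  SigSub (mem_set (conj_closed g H)).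

Definition borel_subgroups := g_sigma_algebraType (@open subgroups).
HB.instance Definition _ := Measurable.on borel_subgroups.

Variable R : realType.
Implicit Types mu : probability borel_subgroups R.
Local Open Scope ring_scope.

Definition invariant_random_subgroup mu : Prop :=
  forall (g : G) (A : set borel_subgroups), measurable A ->
    mu (conj_subgroup g @^-1` A) = mu A.

Definition continuous_measure mu : Prop :=
  forall H : borel_subgroups, mu [set H] = 0%E.

Definition ergodic mu : Prop :=
  forall A : set borel_subgroups, measurable A ->
    (forall g : G, conj_subgroup g @^-1` A = A) -> mu A = 0%E \/ mu A = 1%E.

(* A measure also takes (arbitrary) values on non-measurable sets; restricting
   to the Borel sets identifies the measures that agree on them. *)
Definition continuous_ergodic_irs : set (set borel_subgroups -> \bar R) :=
  [set (mu : set borel_subgroups -> \bar R) \_ measurable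
     | mu in [set mu : probability borel_subgroups R |
         [/\ invariant_random_subgroup mu, continuous_measure mu & ergodic mu]]].
End SubgroupSpace.
Arguments continuous_ergodic_irs : clear implicits.

(* Main.v *)
Require Import Defs.
From HB Require Import structures.
From mathcomp Require Import all_boot all_order all_algebra.
From mathcomp Require Import finmap.
From mathcomp Require Import all_classical all_reals all_analysis.
From mathcomp Require Import zify ring lra.

(** Take Lambda = {omega0} with omega0 = (012)^oo, so that U_Lambda is the first
    Grigorchuk group G, with b = (a, c), c = (a, d), d = (1, b).

    Growth. With weights 3, 3, 2, 1 for a, b, c, d the two sections of an
    element of weight n have total weight at most 5(n + 3)/6, so a bound
    C exp(theta n) on the growth can be bootstrapped to C' exp(9 theta n/10), and
    theta can be made arbitrarily small.  Conversely, iterating Lysenok's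
    substitution sigma embeds the product of two copies of a subset of G in G
    with linear distortion, which gives gamma(56^k) >= 2^(2^k).

    Invariant random subgroups. For a set A of levels, infinite and coinfinite,
    and a boundary point x of the tree, let H_A(x) be the subgroup of the g in G
    acting trivially on the subtrees which leave the ray x at a level in A.  The
    map H_A is equivariant, so it pushes the uniform measure on the boundary to
    an ergodic invariant random subgroup.  As rigid stabilisers are nontrivial,
    H_A is injective, hence this measure has no atom, and the set A can be read
    off from it.  In the other direction, a Borel measure on the space of
    subgroups is determined by its values on the sets {H | F is included in H},
    F finite, so there are at most continuum many of them. *)

Set Implicit Arguments.
Unset Strict Implicit.
Unset Printing Implicit Defensive.

Import Order.TTheory GRing.Theory Num.Theory.

Local Open Scope classical_set_scope.
Local Open Scope card_scope.
Local Open Scope group_scope.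

(** * Words acting on the binary tree *)

Variant gen := Ga | Gb | Gc | Gd.

Definition omega0 : Omega := fun n => Ordinal (ltn_pmod n (isT : (0 < 3)%N)).

Definition gen_act (l : gen) : vertex -> vertex :=
  match l with
  | Ga => a_fun
  | Gb => rec_fun Defs.beta_fun omega0
  | Gc => rec_fun zeta_fun omega0
  | Gd => rec_fun delta_fun omega0
  end.

Definition word_act (w : seq gen) (v : vertex) : vertex := foldr gen_act v w.

(** The automorphism depends on [p] and [o] only through the values [p (o n)], so a shifted
    generator can be recognised as another generator. *)
Lemma eq_rec_fun (p q : 'I_3 -> vertex -> vertex) (o o' : Omega) :
  (forall n, p (o n) = q (o' n)) -> rec_fun p o =1 rec_fun q o'.
Proof.
move=> pq v; elim: v o o' pq => [|[] v IHv] o o' pq //=; last by rewrite pq.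
by congr cons; apply: IHv => n; exact: pq.
Qed.

Lemma modS3 n : (n.+1 %% 3)%N = ((n %% 3).+1 %% 3)%N.
Proof. by rewrite -[n.+1]addn1 -modnDml addn1. Qed.

(* Shifting omega0 permutes its three generators cyclically, whence the
   self-similarity b = (a, c), c = (a, d) and d = (1, b). *)
Lemma gen_act_Gb x v :
  gen_act Gb (x :: v) = x :: (if x then gen_act Gc v else a_fun v).
Proof.
case: x => //=; congr cons; apply: eq_rec_fun => n.
rewrite /Defs.beta_fun/zeta_fun/= modS3.
by have := ltn_pmod n (isT : (0 < 3)%N); case: (n %% 3)%N => [|[|[|]]].
Qed.

Lemma gen_act_Gc x v :
  gen_act Gc (x :: v) = x :: (if x then gen_act Gd v else a_fun v).
Proof.
case: x => //=; congr cons; apply: eq_rec_fun => n.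
rewrite /zeta_fun/delta_fun/= modS3.
by have := ltn_pmod n (isT : (0 < 3)%N); case: (n %% 3)%N => [|[|[|]]].
Qed.

Lemma gen_act_Gd x v :
  gen_act Gd (x :: v) = x :: (if x then gen_act Gb v else v).
Proof.
case: x => //=; congr cons; apply: eq_rec_fun => n.
rewrite /Defs.beta_fun/delta_fun/= modS3.
by have := ltn_pmod n (isT : (0 < 3)%N); case: (n %% 3)%N => [|[|[|]]].
Qed.

Lemma gen_act_Ga x v : gen_act Ga (x :: v) = ~~ x :: v.
Proof. by []. Qed.

Definition gen_actE := (gen_act_Ga, gen_act_Gb, gen_act_Gc, gen_act_Gd).

Arguments gen_act : simpl never.

Lemma gen_act_nil l : gen_act l [::] = [::].
Proof. by case: l. Qed.

Lemma gen_actK l : involutive (gen_act l).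
Proof.
move=> v; elim: v l => [|x v IHv] l; first by rewrite !gen_act_nil.
have aK := a_fun_involutive v.
by case: l; rewrite !gen_actE ?negbK//; case: x;
  rewrite ?IHv ?aK.
Qed.

Lemma gen_act_take l n v : take n (gen_act l v) = gen_act l (take n v).
Proof.
elim: v n l => [|x v IHv] [|n] l; rewrite ?gen_act_nil//= ?take0 ?gen_act_nil//.
have aT : take n (a_fun v) = a_fun (take n v) := IHv n Ga.
by case: l; rewrite !gen_actE //=; case: x; rewrite ?IHv ?aT.
Qed.

Lemma size_gen_act l v : size (gen_act l v) = size v.
Proof.
elim: v l => [|x v IHv] l; first by rewrite gen_act_nil.
have aS : size (a_fun v) = size v := IHv Ga.
by case: l; rewrite gen_actE //=; case: x; rewrite /= ?IHv ?aS.
Qed.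

Lemma word_act_cat u w v : word_act (u ++ w) v = word_act u (word_act w v).
Proof. exact: foldr_cat. Qed.

Lemma word_act_rev w : cancel (word_act w) (word_act (rev w)).
Proof.
move=> v; elim: w => //= l w IHw.
by rewrite rev_cons -cats1 word_act_cat /= gen_actK IHw.
Qed.

Lemma word_act_nil w : word_act w [::] = [::].
Proof. by elim: w => //= l w ->; exact: gen_act_nil. Qed.

Lemma word_act_take w n v : take n (word_act w v) = word_act w (take n v).
Proof. by elim: w => //= l w IHw; rewrite gen_act_take IHw. Qed.

Lemma size_word_act w v : size (word_act w v) = size v.
Proof. by elim: w => //= l w IHw; rewrite size_gen_act. Qed.

(** * Sections of words and Lysenok's substitution *)

Definition isa (l : gen) : bool := if l is Ga then true else false.

Definition swaps (w : seq gen) : bool := odd (count isa w).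

Definition gen_sec (x : bool) (l : gen) : seq gen :=
  match l with
  | Ga => [::]
  | Gb => [:: if x then Gc else Ga]
  | Gc => [:: if x then Gd else Ga]
  | Gd => if x then [:: Gb] else [::]
  end.

(** Words act from the right, so [l] meets the first letter of the vertex after [w'] has acted on
    it. *)
Fixpoint word_sec (w : seq gen) (x : bool) : seq gen :=
  if w is l :: w' then gen_sec (x (+) swaps w') l ++ word_sec w' x else [::].

Lemma word_act_cons w x v :
  word_act w (x :: v) = (x (+) swaps w) :: word_act (word_sec w x) v.
Proof.
elim: w => [|l w IHw]; first by rewrite addbF.
rewrite [word_act _ _]/= IHw /= word_act_cat.
rewrite /swaps /= oddD -/(swaps w).
by case: l; rewrite gen_actE /= ?addbN ?addNb//; case: (x (+) swaps w).
Qed.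

Definition gsigma (l : gen) : seq gen :=
  match l with Ga => [:: Ga; Gc; Ga] | Gb => [:: Gd] | Gc => [:: Gb]
  | Gd => [:: Gc] end.

Definition gphi (l : gen) : seq gen :=
  match l with Ga => [:: Gd] | Gb => [::] | Gc => [:: Ga] | Gd => [:: Ga] end.

(* Lysenok's substitution: sigma w = (phi w, w). *)
Definition sigma (w : seq gen) : seq gen := flatten (map gsigma w).
Definition phi (w : seq gen) : seq gen := flatten (map gphi w).

Lemma sigma_cat u w : sigma (u ++ w) = sigma u ++ sigma w.
Proof. by rewrite /sigma map_cat flatten_cat. Qed.

Lemma phi_cat u w : phi (u ++ w) = phi u ++ phi w.
Proof. by rewrite /phi map_cat flatten_cat. Qed.

Lemma sigma_true w v : word_act (sigma w) (true :: v) = true :: word_act w v.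
Proof.
by elim: w => //= l w IHw; rewrite word_act_cat IHw; case: l;
  rewrite /= ?gen_actE.
Qed.

Lemma sigma_false w v :
  word_act (sigma w) (false :: v) = false :: word_act (phi w) v.
Proof.
by elim: w => //= l w IHw; rewrite !word_act_cat IHw; case: l;
  rewrite /= ?gen_actE.
Qed.

Definition isbc (l : gen) : bool :=
  match l with Gb | Gc => true | _ => false end.

Definition bc_odd (w : seq gen) : bool := odd (count isbc w).

Lemma bc_odd_cat u w : bc_odd (u ++ w) = bc_odd u (+) bc_odd w.
Proof. by rewrite /bc_odd count_cat oddD. Qed.

(** The map phi o sigma^2 sends a to (dad)(dad) = 1, d to the empty word, and both b and c to a, so
    only the parity of the number of letters b and c survives. *)
Lemma phi_sigma2 w v :
  word_act (phi (sigma (sigma w))) v = if bc_odd w then a_fun v else v.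
Proof.
elim: w v => //= l w IHw v.
rewrite /sigma /= -/sigma -/(sigma _) sigma_cat phi_cat word_act_cat IHw.
rewrite /bc_odd /= oddD -/(bc_odd w).
have aK := gen_actK Ga; rewrite /= in aK.
have dK := gen_actK Gd; rewrite /= in dK.
by case: l; rewrite /= ?dK ?aK ?dK //; case: (bc_odd w); rewrite /= ?aK.
Qed.

(** The cube of sigma fixes b, c and d, and turns a into a word with six letters among b and c. *)
Lemma bc_odd_sigma3 w : bc_odd (sigma (sigma (sigma w))) = bc_odd w.
Proof.
elim: w => //= l w IHw.
rewrite -[l :: w]cat1s !sigma_cat !bc_odd_cat IHw; congr addb.
by case: l.
Qed.

Lemma size_sigma w : (size (sigma w) <= 3 * size w)%N.
Proof.
elim: w => //= l w IHw; rewrite size_cat mulnS leq_add//; by case: l.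
Qed.

Definition sigma3 (w : seq gen) := sigma (sigma (sigma w)).

Lemma size_sigma3 w : (size (sigma3 w) <= 27 * size w)%N.
Proof.
have h1 := size_sigma w; have h2 := size_sigma (sigma w).
have h3 := size_sigma (sigma (sigma w)); rewrite /sigma3; lia.
Qed.

Lemma sigma3_true w v :
  word_act (sigma3 w) [:: true, true, true & v] =
  [:: true, true, true & word_act w v].
Proof. by rewrite /sigma3 !sigma_true. Qed.

Lemma sigma3_false w v : bc_odd w = false ->
  word_act (sigma3 w) (false :: v) = false :: v.
Proof. by move=> ew; rewrite /sigma3 sigma_false phi_sigma2 ew. Qed.

(* When u and w are even, the two factors act on different halves of the tree. *)
Definition pair_word (u w : seq gen) : seq gen :=
  sigma3 u ++ Ga :: sigma3 w ++ [:: Ga].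

Lemma bc_odd_pair u w : bc_odd u = false -> bc_odd w = false ->
  bc_odd (pair_word u w) = false.
Proof.
move=> eu ew; rewrite /pair_word -[Ga :: _]cat1s !bc_odd_cat /sigma3.
by rewrite !bc_odd_sigma3 eu ew.
Qed.

Lemma size_pair u w n : (size u <= n)%N -> (size w <= n)%N ->
  (size (pair_word u w) <= 54 * n + 2)%N.
Proof.
move=> un wn; rewrite /pair_word size_cat /= size_cat /=.
have := size_sigma3 u; have := size_sigma3 w; lia.
Qed.

(** Below 111 only [sigma3 u] acts, and it acts as u; below 011 only the conjugate of [sigma3 w] by
    a acts, and it acts as w. *)
Lemma pair_word_inj u w u' w' :
  bc_odd u = false -> bc_odd w = false ->
  bc_odd u' = false -> bc_odd w' = false ->
  word_act (pair_word u w) =1 word_act (pair_word u' w') ->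
  word_act u =1 word_act u' /\ word_act w =1 word_act w'.
Proof.
move=> eu ew eu' ew' e; split=> v.
  have := e [:: true, true, true & v]; rewrite /pair_word !word_act_cat /=.
  by rewrite !word_act_cat /= !sigma3_false//= !sigma3_true => -[].
have := e [:: false, true, true & v]; rewrite /pair_word !word_act_cat /=.
by rewrite !word_act_cat /= !sigma3_true//= !sigma3_false// => -[].
Qed.

(** Since [sigma w] acts as w below 1, it handles the vertices 1v; a preliminary letter a moves 0v
    to 1v. *)
Lemma word_transitive v :
  exists w, word_act w v = nseq (size v) true.
Proof.
elim: v => [|x v [w vw]]; first by exists [::].
exists (sigma w ++ if x then [::] else [:: Ga]).
by rewrite word_act_cat; case: x; rewrite /= sigma_true vw.
Qed.

(** The images of abab under the iterates of sigma have trivial left sections, which confines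
    [iter n sigma tword] to the subtree below 1^n. *)
Definition tword : seq gen := [:: Ga; Gb; Ga; Gb].

(** The element (da)^2 acts on both halves of the tree as the involution b. *)
Lemma ad4 v : word_act [:: Gd; Ga; Gd; Ga; Gd; Ga; Gd; Ga] v = v.
Proof.
case: v => //= -[] v; rewrite ?gen_actE /= ?gen_actE /=; have bK := gen_actK Gb v;
  by rewrite /= in bK; do ?rewrite ?bK ?gen_actE //=.
Qed.

(** For n = 0 the word is dd and for n = 1 it is (da)^4; from n = 2 on the parity criterion applies,
    [tword] being a square. *)
Lemma phi_iter_tword n v : word_act (phi (iter n sigma tword)) v = v.
Proof.
case: n => [|[|n]]; [exact: (gen_actK Gd)|exact: ad4|].
rewrite !iterS phi_sigma2.
rewrite -[tword]/([:: Ga; Gb] ++ [:: Ga; Gb]).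
suff -> : forall u, bc_odd (iter n sigma (u ++ u)) = false by [].
move=> u; have -> : iter n sigma (u ++ u) = iter n sigma u ++ iter n sigma u.
  by elim: n => //= n ->; rewrite sigma_cat.
by rewrite bc_odd_cat addbb.
Qed.

Lemma iter_sigma_in n w v :
  word_act (iter n sigma w) (nseq n true ++ v) = nseq n true ++ word_act w v.
Proof. by elim: n => //= n IHn; rewrite sigma_true IHn. Qed.

Lemma iter_sigma_out n v : ~~ prefix (nseq n true) v ->
  word_act (iter n sigma tword) v = v.
Proof.
elim: n v => [|n IHn] [|[] v] //=; first by rewrite word_act_nil.
- by move=> h; rewrite sigma_true IHn.
- by move=> _; rewrite sigma_false phi_iter_tword.
Qed.

(** * The group of the sequence (012)^oo and its growth *)

Definition Lambda0 : set Omega := [set omega0].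

Definition G0 : groupType := U_ Lambda0.

Definition gact (g : G0) : vertex -> vertex :=
  aut_fun (fg_lift (S_ omega0) (repr g)).

Lemma mem_N0 (x : F4) :
  (x \in nsub_bigcap Lambda0 N_) = (fg_lift (S_ omega0) x == 1).
Proof.
apply/idP/idP => [|x1]; rewrite inE.
  by move=> /(_ omega0 erefl).
by move=> _ ->.
Qed.

Lemma projK (g : G0) : quot_proj (nsub_bigcap Lambda0 N_) (repr g) = g.
Proof. exact: reprK. Qed.

Lemma gact_proj (x : F4) :
  gact (quot_proj (nsub_bigcap Lambda0 N_) x) = fg_lift (S_ omega0) x.
Proof.
rewrite /gact; congr aut_fun.
set y := repr _.
have /eqP : quot_proj (nsub_bigcap Lambda0 N_) (y^-1 * x) == 1.
  rewrite gmulfM gmulfV /= /y projK; exact/eqP/mulVg.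
move/eqP; rewrite quot_proj_eq1 mem_N0 gmulfM gmulfV => /eqP h.
by rewrite -[LHS]mulg1 -h mulgA mulgV mul1g.
Qed.

Lemma gactM g h : gact (g * h) = gact g \o gact h.
Proof.
rewrite -[g]projK -[h]projK -gmulfM !gact_proj gmulfM.
by [].
Qed.

Lemma gact1 : gact 1 = id.
Proof.
have -> : 1 = quot_proj (nsub_bigcap Lambda0 N_) 1 :> G0 by rewrite gmulf1.
by rewrite gact_proj gmulf1.
Qed.

Lemma gact_inj g h : gact g =1 gact h -> g = h.
Proof.
move=> e; rewrite -[g]projK -[h]projK.
suff : quot_proj (nsub_bigcap Lambda0 N_) ((repr g)^-1 * repr h) = 1.
  rewrite gmulfM gmulfV => e1.
  by rewrite -[LHS]mulg1 -e1 mulgA mulgV mul1g.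
apply/eqP; rewrite quot_proj_eq1 mem_N0 gmulfM gmulfV /=; apply/eqP.
suff -> : fg_lift (S_ omega0) (repr g) = fg_lift (S_ omega0) (repr h).
  by rewrite mulVg.
by apply: val_inj; apply/funext.
Qed.

Definition gen_idx (l : gen) : 'I_4 :=
  match l with
  | Ga => inord 0 | Gb => inord 1 | Gc => inord 2 | Gd => inord 3
  end.

Definition idx_gen (i : 'I_4) : gen :=
  match val i with 0%N => Ga | 1%N => Gb | 2%N => Gc | _ => Gd end.

Lemma gen_idxK : cancel gen_idx idx_gen.
Proof. by case; rewrite /idx_gen /= inordK. Qed.

HB.instance Definition _ := Equality.copy gen (can_type gen_idxK).

Lemma gact_gen i : gact (U_gen Lambda0 i) = gen_act (idx_gen i).
Proof.
rewrite /U_gen gact_proj fg_lift_gen /S_ (tnth_nth 1).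
by case: i => -[|[|[|[|i]]]].
Qed.

(** Inverse letters are read as the letters themselves, the generators being involutions. *)
Lemma gact_eval (w : seq ('I_4 * bool)) :
  gact (eval_word (U_gen Lambda0) w) = word_act [seq idx_gen l.1 | l <- w].
Proof.
elim: w => [|[i b] w IHw]; first by rewrite /eval_word big_nil gact1.
rewrite /eval_word big_cons gactM IHw /=; apply/funext => v /=.
case: b => /=; last by rewrite gact_gen.
apply: (can_inj (gen_actK (idx_gen i))).
by rewrite gen_actK -gact_gen -[LHS]/((gact _ \o gact _) _) -gactM mulgV gact1.
Qed.

Definition gword (w : seq gen) : G0 :=
  eval_word (U_gen Lambda0) [seq (gen_idx l, false) | l <- w].

Lemma gact_gword w : gact (gword w) = word_act w.
Proof.
by rewrite /gword gact_eval -map_comp (eq_map (g := id)) ?map_id// => l /=;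
  rewrite gen_idxK.
Qed.

Lemma gword_eq u w : word_act u =1 word_act w -> gword u = gword w.
Proof. by move=> uw; apply: gact_inj => v; rewrite !gact_gword. Qed.

Lemma eval_word_gword (w : seq ('I_4 * bool)) :
  eval_word (U_gen Lambda0) w = gword [seq idx_gen l.1 | l <- w].
Proof. by apply: gact_inj => v; rewrite gact_eval gact_gword. Qed.

Lemma gword_surj g : exists w, gword w = g.
Proof.
exists [seq idx_gen l.1 | l <- fg_word (repr g)].
rewrite -eval_word_gword -[RHS]projK.
by rewrite (fg_lift_unique (S := U_gen Lambda0)).
Qed.

Lemma word_ballE n :
  word_ball (U_gen Lambda0) n = [set g | exists2 w, (size w <= n)%N & gword w = g].
Proof.
apply/seteqP; split=> g [w wn <-].
  by exists [seq idx_gen l.1 | l <- w]; rewrite ?size_map// eval_word_gword.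
by exists [seq (gen_idx l, false) | l <- w]; rewrite ?size_map.
Qed.

Lemma growth_ub n (s : seq G0) :
  (forall w, (size w <= n)%N -> gword w \in s) ->
  (growth (U_gen Lambda0) n <= size s)%N.
Proof.
move=> ws; rewrite /growth.
apply: (@leq_trans #|` [fset x in s]%fset|).
  apply: fsubset_leq_card; apply/fsubsetP => g.
  rewrite in_fset_set; last exact: finite_word_ball.
  rewrite inE/= word_ballE => -[w wn <-].
  by rewrite inE ws.
by rewrite card_fseq size_undup.
Qed.

Lemma growth_lb n (s : seq G0) : uniq s ->
  (forall g, g \in s -> exists2 w, (size w <= n)%N & gword w = g) ->
  (size s <= growth (U_gen Lambda0) n)%N.
Proof.
move=> us sw; rewrite /growth -(undup_id us) -card_fseq.
apply: fsubset_leq_card; apply/fsubsetP => g; rewrite inE => gs.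
rewrite in_fset_set; last exact: finite_word_ball.
by rewrite inE/= word_ballE; exact: sw.
Qed.

(** * Lower bound: the growth is not polynomial *)

Fixpoint even_words (k : nat) : seq (seq gen) :=
  if k is k'.+1 then allpairs pair_word (even_words k') (even_words k')
  else [:: [::]; [:: Ga]].

(** A pair has length at most 54 * 56^k + 2, and the base 56 absorbs the 2 because 56^k >= 1. *)
Lemma even_wordsP k w : w \in even_words k ->
  bc_odd w = false /\ (size w <= 56 ^ k)%N.
Proof.
elim: k w => [|k IHk] w /=; first by rewrite !inE => /orP[]/eqP ->.
case/allpairsP => -[u v] /= [/IHk[eu su] /IHk[ev sv] ->].
split; first exact: bc_odd_pair.
rewrite (leq_trans (size_pair su sv))// expnS.
have := expn_gt0 56 k; lia.
Qed.

Lemma size_even_words k : size (even_words k) = (2 ^ 2 ^ k)%N.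
Proof.
by elim: k => //= k IHk; rewrite size_allpairs IHk -expnD addnn -mul2n -expnS.
Qed.

Lemma even_words_inj k : {in even_words k &, injective gword}.
Proof.
have act u w : gword u = gword w -> word_act u =1 word_act w.
  by move=> e v; rewrite -!gact_gword e.
elim: k => [|k IHk] u w /=.
  rewrite !inE => /orP[]/eqP -> /orP[]/eqP -> // /act /(_ [:: true]);
  by rewrite /= gen_act_Ga.
case/allpairsP => -[u1 u2] /= [h1 h2 ->].
case/allpairsP => -[w1 w2] /= [h3 h4 ->] /act e.
have [e1 _] := even_wordsP h1; have [e2 _] := even_wordsP h2.
have [e3 _] := even_wordsP h3; have [e4 _] := even_wordsP h4.
have [/gword_eq/IHk -> // /gword_eq/IHk -> //] := pair_word_inj e1 e2 e3 e4 e.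
Qed.

Lemma even_words_uniq k : uniq (even_words k).
Proof.
elim: k => // k IHk /=.
apply: allpairs_uniq => // -[u1 u2] [w1 w2] /=.
move=> /allpairsP[[u u'] /= [h1 h2 [-> ->]]] /allpairsP[[w w'] /= [h3 h4 [-> ->]]].
have [e1 _] := even_wordsP h1; have [e2 _] := even_wordsP h2.
have [e3 _] := even_wordsP h3; have [e4 _] := even_wordsP h4.
move=> e; have [|] := pair_word_inj e1 e2 e3 e4; first by rewrite e.
by move=> /gword_eq/(even_words_inj h1 h3) -> /gword_eq/(even_words_inj h2 h4) ->.
Qed.

Lemma growth_tower k : (2 ^ 2 ^ k <= growth (U_gen Lambda0) (56 ^ k))%N.
Proof.
rewrite -size_even_words -(size_map gword); apply: growth_lb.
  by rewrite map_inj_in_uniq ?even_words_uniq//; exact: even_words_inj.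
move=> g /mapP[w wk ->]; exists w => //; by have [] := even_wordsP wk.
Qed.

(** With C <= 2^C and 56 <= 2^6, a bound (C 56^k)^D on 2^(2^k) forces 2^k <= (C + 6k) D, an
    exponential against a linear function of k. *)
Lemma not_polynomial (R : realType) : ~ polynomial_growth R (U_gen Lambda0).
Proof.
case=> d d0 [C C0 hC]; pose D := (Num.truncn d).+1.
have dD : (d <= D%:R)%R by rewrite ltW// Num.Theory.truncnS_gt.
have bound k : (2 ^ k <= (C + 6 * k) * D)%N.
  have := hC (56 ^ k)%N; rewrite expn_gt0 => /(_ isT) gk.
  have : ((2 ^ 2 ^ k)%:R <= ((C * 56 ^ k) ^ D)%:R :> R)%R.
    apply: le_trans (le_trans gk _); first by rewrite ler_nat growth_tower.
    rewrite [leRHS]natrX -powR_mulrn//.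
    apply: ler_powR => //; rewrite ler1n muln_gt0 C0 expn_gt0//.
  rewrite ler_nat => h.
  have {}h : (2 ^ 2 ^ k <= 2 ^ ((C + 6 * k) * D))%N.
    rewrite (leq_trans h)// expnM leq_exp2r// expnD leq_mul//.
      by apply: ltnW; exact: ltn_expl.
    by rewrite expnM; case: (k) => // j; rewrite leq_exp2r.
  by rewrite leq_exp2l in h.
(* At k = 2m the linear side is at most (C + 12) m D = m^2, which is below (m + 1)^2 <= 4^m. *)
pose m := ((C + 12) * D)%N.
have := bound (2 * m)%N.
have m0 : (0 < m)%N by rewrite /m /D; lia.
have h1 : (m.+1 <= 2 ^ m)%N by exact: ltn_expl.
rewrite mul2n -addnn expnD.
have h2 : (m.+1 * m.+1 <= 2 ^ m * 2 ^ m)%N by exact: leq_mul.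
have h3 : ((C + 6 * (m + m)) * D <= (C + 12) * m * D)%N.
  by rewrite leq_mul2r; apply/orP; right; nia.
have h4 : ((C + 12) * m * D = m * m)%N by rewrite {2}/m; lia.
nia.
Qed.

(** * Upper bound: the growth is not exponential *)

Definition wt (l : gen) : nat :=
  match l with Ga => 3 | Gb => 3 | Gc => 2 | Gd => 1 end.

Definition wweight (w : seq gen) : nat := sumn (map wt w).

Lemma wweight_cat u w : wweight (u ++ w) = (wweight u + wweight w)%N.
Proof. by rewrite /wweight map_cat sumn_cat. Qed.

Lemma size_wweight w : (size w <= wweight w <= 3 * size w)%N.
Proof.
elim: w => //= l w /andP[h1 h2]; rewrite /wweight /= -/(wweight w).
by case: l => /=; apply/andP; split; lia.
Qed.

(** The multiplication table of the Klein four-group {1, b, c, d}, together with aa = 1; the last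
    case holds the pairs with exactly one a, which do not simplify. *)
Definition gmul (l k : gen) : seq gen :=
  match l, k with
  | Ga, Ga | Gb, Gb | Gc, Gc | Gd, Gd => [::]
  | Gb, Gc | Gc, Gb => [:: Gd]
  | Gb, Gd | Gd, Gb => [:: Gc]
  | Gc, Gd | Gd, Gc => [:: Gb]
  | _, _ => [:: l; k]
  end.

(** The relations are proved together, since a relation at 1v descends to another one at v: bc = d
    becomes cd = b. *)
Lemma word_act_gmul l k v : word_act (gmul l k) v = gen_act l (gen_act k v).
Proof.
elim: v l k => [|x v IHv] l k; first by rewrite word_act_nil !gen_act_nil.
have aK : a_fun (a_fun v) = v := gen_actK Ga v.
have bc := IHv Gb Gc; have cb := IHv Gc Gb; have bd := IHv Gb Gd.
have db := IHv Gd Gb; have cd := IHv Gc Gd; have dc := IHv Gd Gc.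
rewrite /= in bc cb bd db cd dc.
by case: l; case: k; rewrite /= ?gen_actE ?negbK //; case: x;
  rewrite //= ?gen_actK ?aK -?bc -?cb -?bd -?db -?cd -?dc.
Qed.

Definition insert_gen (l : gen) (w : seq gen) : seq gen :=
  if w is k :: w' then gmul l k ++ w' else [:: l].

Definition normal_word (w : seq gen) : seq gen := foldr insert_gen [::] w.

Definition alternating (w : seq gen) : bool :=
  sorted (fun k l => isa k != isa l) w.

Lemma alternating_insert l w : alternating w -> alternating (insert_gen l w).
Proof.
rewrite /alternating; case: w => [|k [|j w]] //=; first by case: l; case: k.
by case/andP; case: l; case: k; case: j.
Qed.

Lemma alternating_normal w : alternating (normal_word w).
Proof. by elim: w => //= l w; exact: alternating_insert. Qed.

(** The weights 3, 2, 1 of b, c, d satisfy the triangle inequality, so merging two letters never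
    increases the weight. *)
Lemma wweight_normal w : (wweight (normal_word w) <= wweight w)%N.
Proof.
have ins l u : (wweight (insert_gen l u) <= wt l + wweight u)%N.
  case: u => [|k u]; first by rewrite /wweight /=.
  rewrite /insert_gen wweight_cat /wweight /= addnA leq_add2r.
  by case: l; case: k.
elim: w => //= l w IHw; apply: leq_trans (ins _ _) _.
by rewrite /wweight /= leq_add2l.
Qed.

Lemma word_act_normal w v : word_act (normal_word w) v = word_act w v.
Proof.
elim: w => //= l w <-; case: (normal_word w) => //= k u.
by rewrite word_act_cat word_act_gmul.
Qed.

Lemma alternating_count w : alternating w ->
  (count (predC isa) w <= (count isa w).+1)%N.
Proof.
have h l u : path (fun k j => isa k != isa j) l u ->
    (count (predC isa) u <= count isa u + isa l)%N.
  elim: u l => //= k u IHu l /andP[lk /IHu].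
  by move: lk; case: (isa l); case: (isa k) => //= _; lia.
case: w => //= l w /h; case: (isa l) => /=; lia.
Qed.

(* The weights 3, 3, 2, 1 make every pair a b, a c, a d contract by a factor
   at most 5/6. *)
Lemma wweight_sec w :
  (6 * (wweight (word_sec w false) + wweight (word_sec w true)) +
   15 * count isa w <= 5 * wweight w + 15 * count (predC isa) w)%N.
Proof.
elim: w => //= l w; rewrite !wweight_cat [wweight (l :: w)]/wweight /=.
rewrite -/(wweight w).
move: (wweight (word_sec w false)) (wweight (word_sec w true)) (wweight w).
move: (count isa w) (count (predC isa) w) => i j p q r IHw.
by case: l; case: (swaps w); rewrite /wweight /=; lia.
Qed.

(** In an alternating word the letters b, c, d outnumber the letters a by at most one; the resulting
    excess 15 is 5 times the 3 added to the weight. *)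
Lemma sections_contract w : exists2 w', word_act w' =1 word_act w &
  (6 * (wweight (word_sec w' false) + wweight (word_sec w' true)) <=
   5 * (wweight w + 3))%N.
Proof.
exists (normal_word w); first exact: word_act_normal.
have := wweight_sec (normal_word w).
have := alternating_count (alternating_normal w).
have := wweight_normal w; lia.
Qed.

(** A possibly redundant list stands in for the ball of weight [n], so that only lengths of lists
    have to be estimated. *)
Definition covers (n : nat) (s : seq G0) : Prop :=
  forall w, (wweight w <= n)%N -> gword w \in s.

(** An element is determined by its action on the first level, hence the factor 2, and by its two
    sections, whose weights add up to at most [m]. *)
Lemma covers_step (s : nat -> seq G0) (n : nat) : (forall i, covers i (s i)) ->
  let m := ((5 * (n + 3)) %/ 6)%N in
  exists2 t, covers n t &
    (size t <= 2 * \sum_(i < m.+1) size (s i) * size (s (m - i)))%N.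
Proof.
move=> cs m.
(* Reassembles an element from its swap bit and its sections; the default is 1 when no element has
   them. *)
pose dec (b : bool) (p : G0 * G0) : G0 :=
  xget 1 [set g | forall x v,
    gact g (x :: v) = (x (+) b) :: gact (if x then p.2 else p.1) v].
pose ps := flatten [seq [seq (g0, g1) | g0 <- s i, g1 <- s (m - i)%N]
                   | i <- iota 0 m.+1].
exists ([seq dec false p | p <- ps] ++ [seq dec true p | p <- ps]).
  move=> w wn; have [w' w'w sec] := sections_contract w.
  have -> : gword w =
      dec (swaps w') (gword (word_sec w' false), gword (word_sec w' true)).
    rewrite /dec; case: xgetP => [g _ /= hg|/(_ (gword w))[]].
      apply: gact_inj => -[|x v]; rewrite gact_gword -w'w.
        by rewrite word_act_nil; have [u <-] := gword_surj g;
          rewrite gact_gword word_act_nil.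
      by rewrite hg word_act_cons; case: x; rewrite gact_gword.
    by move=> x v; rewrite gact_gword -w'w word_act_cons; case: x;
      rewrite gact_gword.
  set p := (_, _).
  have pps : p \in ps.
    (* The left section has weight exactly [i], which leaves at most [m - i] for the right one. *)
    pose i := wweight (word_sec w' false).
    have im : (i + wweight (word_sec w' true) <= m)%N.
      rewrite /m leq_divRL// mulnC (leq_trans sec)// leq_mul2l/=.
      by rewrite leq_add2r.
    apply/flattenP; exists [seq (g0, g1) | g0 <- s i, g1 <- s (m - i)%N].
      by apply/mapP; exists i => //; rewrite mem_iota; lia.
    apply: allpairs_f; apply: cs => //; lia.
  by rewrite mem_cat; case: (swaps w'); rewrite (map_f _ pps) ?orbT.
rewrite size_cat !size_map addnn -mul2n leq_mul2l/= /ps size_flatten /shape.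
rewrite -map_comp sumnE big_map -[iota 0 _]/(index_iota 0 m.+1) big_mkord.
by apply: leq_sum => i _ /=; rewrite size_allpairs.
Qed.

Section Subexponential.
Variable R : realType.
Local Open Scope ring_scope.

Definition exp_bounded (theta : R) : Prop :=
  exists2 C : R, 0 < C & forall n, exists2 s, covers n s &
    (size s)%:R <= C * expR (theta * n%:R).

(** Words of weight at most n have length at most n, a list of 5^n elements covers these, and 5 = 1
    + 4 <= e^4. *)
Lemma exp_bounded4 : exp_bounded 4.
Proof.
exists 1 => // n.
have [s cs ss] : exists2 s, (forall w, (size w <= n)%N -> gword w \in s) &
    (size s = 5 ^ n)%N.
  elim: n => [|n [s cs ss]].
    by exists [:: gword [::]] => // -[|//] _; rewrite mem_head.
  exists (s ++ [seq gword [:: l] * g | l <- [:: Ga; Gb; Gc; Gd], g <- s])%g.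
    case=> [|l w] wn; first by rewrite mem_cat cs.
    have -> : gword (l :: w) = (gword [:: l] * gword w)%g.
      by apply: gact_inj => v; rewrite gactM /= !gact_gword.
    rewrite mem_cat; apply/orP; right.
    apply/allpairsP; exists (l, gword w); split=> //; last exact: cs.
    by case: l {wn}; rewrite !inE eqxx ?orbT.
  by rewrite size_cat size_allpairs ss expnS /=; lia.
exists s.
  move=> w wn; apply: cs; have /andP[h _] := size_wweight w.
  exact: leq_trans h wn.
rewrite ss mul1r natrX mulrC expRM_natl lerXn2r ?nnegrE ?expR_ge0//.
by apply: le_trans (expR_ge1Dx _); lra.
Qed.

(** Multiplying the bounds for the two sections gives (m + 1) C^2 e^(theta m) with m about 5n/6; the
    factor m + 1 is paid for by e^(theta n/15), and 5/6 + 1/15 = 9/10. *)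
Lemma exp_bounded_step (theta : R) : 0 < theta ->
  exp_bounded theta -> exp_bounded (9 / 10 * theta).
Proof.
move=> t0 [C C0 hC].
(* The 2 counts swap bits, [C * C] the two sections, [15 / theta + 4] compares m + 1 with e^(theta
   n/15), and the last factor comes from the constant in m <= 5n/6 + 5/2. *)
pose D := 2 * (C * C) * (15 / theta + 4) * expR (5 / 2 * theta).
have D0 : 0 < D.
  by rewrite /D !mulr_gt0 ?expR_gt0// addr_gt0// divr_gt0.
exists D => // n.
pose s i := projT1 (cid2 (hC i)).
have cs i : covers i (s i) by rewrite /s; case: cid2.
have ss i : (size (s i))%:R <= C * expR (theta * i%:R).
  by rewrite /s; case: cid2.
have [t ct st] := covers_step n cs; exists t => //.
move: st; set m := (_ %/ _)%N => st.
have mn : (6 * m <= 5 * (n + 3))%N by rewrite mulnC leq_trunc_div.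
have mnR : m%:R <= 5 / 6 * n%:R + 5 / 2 :> R.
  have : (6 * m)%:R <= (5 * (n + 3))%:R :> R by rewrite ler_nat.
  by rewrite !natrM natrD; lra.
have h1 : (size t)%:R <= 2 * (m.+1%:R * (C * C * expR (theta * m%:R))).
  apply: (@le_trans _ _ (2 * \sum_(i < m.+1) (size (s i))%:R * (size (s (m - i)%N))%:R)).
    move: st; rewrite -(ler_nat R) natrM natr_sum => /le_trans; apply.
    by rewrite ler_pM2l//; apply: ler_sum => i _; rewrite natrM.
  rewrite ler_pM2l// -[m.+1 in leRHS]card_ord mulr_natl -sumr_const.
  apply: ler_sum => i _; apply: le_trans (ler_pM _ _ (ss i) (ss (m - i)%N)) _ => //.
  rewrite mulrACA -expRD -mulrDr -natrD subnKC//.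
  by have := ltn_ord i.
apply: (le_trans h1).
have h2 : expR (theta * m%:R) <= expR (5 / 6 * theta * n%:R) * expR (5 / 2 * theta).
  rewrite -expRD ler_expR; have := ler_wpM2l (ltW t0) mnR; lra.
have h3 : m.+1%:R <= (15 / theta + 4) * expR (theta * n%:R / 15).
  have e1 : 1 + theta * n%:R / 15 <= expR (theta * n%:R / 15) by exact: expR_ge1Dx.
  have n0 : 0 <= n%:R :> R by [].
  have h4 : n%:R <= 15 / theta * expR (theta * n%:R / 15).
    rewrite mulrAC ler_pdivlMr//; lra.
  have h5 : 1 <= expR (theta * n%:R / 15).
    apply: le_trans e1; rewrite lerDl divr_ge0// mulr_ge0// ltW//.
  rewrite -natr1; lra.
have -> : 9 / 10 * theta * n%:R = theta * n%:R / 15 + 5 / 6 * theta * n%:R by lra.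
have C2 : 0 < C * C by exact: mulr_gt0.
have h4 := ler_pM (ler0n R m.+1) (expR_ge0 (theta * m%:R)) h3 h2.
have h5 := ler_wpM2l (ltW C2) h4.
rewrite expRD /D; lra.
Qed.

Lemma exp_bounded_small (eta : R) : 0 < eta ->
  exists2 theta, 0 < theta <= eta & exp_bounded theta.
Proof.
move=> eta0.
have [k hk] : exists k, (9 / 10) ^+ k * 4 <= eta.
  have := @cvg_expr R (9 / 10) _; rewrite ger0_norm; last lra.
  move=> /(_ ltac:(lra)) /cvgrPdist_le /(_ (eta / 4)) [|k _ hk]; first lra.
  exists k; have := hk k (leqnn k); rewrite /= sub0r normrN ger0_norm; first lra.
  by apply: exprn_ge0; lra.
exists ((9 / 10) ^+ k * 4).
  by rewrite hk andbT mulr_gt0// exprn_gt0.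
elim: k {hk} => [|k IHk]; first by rewrite expr0 mul1r; exact: exp_bounded4.
by rewrite exprS -mulrA; apply: exp_bounded_step.
Qed.

Lemma not_exponential : ~ exponential_growth R (U_gen Lambda0).
Proof.
case=> _ [K K0 hK].
have K0R : 0 < K%:R :> R by rewrite ltr0n.
(* A word of length Kn has weight at most 3Kn, so such a theta bounds the growth at Kn by C
   e^(n/2). *)
have [|theta /andP[t0 tK] [C C0 hC]] := @exp_bounded_small ((6 * K%:R)^-1).
  by rewrite invr_gt0 mulr_gt0.
(* Makes n/2 larger than C, so that C e^(n/2) < e^n. *)
pose n := (2 * (Num.truncn C).+1)%N.
have := hK n isT; apply/negP; rewrite -ltNge.
have [s cs ss] := hC (3 * (K * n))%N.
have gs : (growth (U_gen Lambda0) (K * n) <= size s)%N.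
  apply: growth_ub => w wn; apply: cs; have /andP[_ h] := size_wweight w.
  by apply: leq_trans h _; rewrite leq_mul2l.
apply: (@le_lt_trans _ _ (size s)%:R); first by rewrite ler_nat.
apply: (le_lt_trans ss).
have h1 : theta * (3 * (K * n))%:R <= n%:R / 2.
  have := ler_wpM2r (_ : 0 <= (3 * (K * n))%:R :> R) tK.
  move=> /(_ (ler0n _ _))/le_trans; apply.
  rewrite (natrM _ 3) (natrM _ K); move: (n%:R : R) => z.
  have -> : (6 * K%:R)^-1 * (3 * (K%:R * z)) = z / 2.
    by field; rewrite gt_eqF.
  by [].
apply: (@le_lt_trans _ _ (C * expR (n%:R / 2))).
  by rewrite ler_pM2l// ler_expR.
have -> : expR n%:R = expR (n%:R / 2) * expR (n%:R / 2) :> R.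
  by rewrite -expRD; congr expR; lra.
rewrite ltr_pM2r ?expR_gt0//.
have Cn : C < n%:R / 2.
  have := Num.Theory.truncnS_gt C; rewrite /n natrM; lra.
have := expR_ge1Dx (n%:R / 2 : R); lra.
Qed.

Lemma intermediate0 : intermediate_growth R (U_gen Lambda0).
Proof. by split; [exact: not_polynomial|exact: not_exponential]. Qed.
End Subexponential.

(** * The Borel structure on the space of subgroups *)

Section BorelSubgroups.
Variables (G : groupType) (e : nat -> G).
Hypothesis e_surj : forall g, exists n, e n = g.

Definition sub_mem (H : subgroups G) (g : G) : bool := set_val H g.

Lemma subgroups_eq (H K : subgroups G) : sub_mem H =1 sub_mem K -> H = K.
Proof. by move=> HK; apply: val_inj; apply/funext. Qed.

Definition above (s : seq G) : set (subgroups G) := [set H | all (sub_mem H) s].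

Lemma open_sub_mem (g : G) : open [set H : subgroups G | sub_mem H g].
Proof.
exists [set f : {ptws G -> bool} | f g] => //.
rewrite openE => f fg; rewrite /interior.
have /cvg_sup c : nbhs (f : {ptws G -> bool}) --> (f : {ptws G -> bool}) by [].
apply: (c g); rewrite nbhsE; exists [set h : G -> bool | h g] => //; split=> //.
exists [set true]; first exact: discrete_open.
by apply/seteqP; split.
Qed.

(** The filter generated by agreement with [H] on initial segments of the enumeration converges to
    [H] in each coordinate, hence in the product topology. *)
Lemma open_local (U : set (subgroups G)) (H : subgroups G) : open U -> U H ->
  exists n, forall K, (forall i, (i < n)%N -> sub_mem K (e i) = sub_mem H (e i)) ->
    U K.
Proof.
case=> V oV <- /= VH.
pose N (n : nat) :=
  [set f : G -> bool | forall i, (i < n)%N -> f (e i) = set_val H (e i)].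
pose F := filter_from [set: nat] N.
have FF : Filter F.
  apply: filter_from_filter; first by exists 0%N.
  move=> i j _ _; exists (maxn i j) => // f fN.
  by split=> k ki; apply: fN; rewrite leq_max ki ?orbT.
have cF : F --> (set_val H : {ptws G -> bool}).
  apply/cvg_sup => g A; rewrite nbhsE => -[B [[C oC <-] /= CH] BA].
  have [i ig] := e_surj g.
  exists i.+1 => // f fN; apply: BA => /=.
  by rewrite -ig fN ?ig.
have [|n _ Nn] := cF V; first exact: open_nbhs_nbhs.
exists n => K KH; exact: Nn.
Qed.

Definition matching (t : seq bool) : set (subgroups G) :=
  [set K | forall i, (i < size t)%N -> sub_mem K (e i) = nth false t i].

Lemma measurable_above1 (g : G) (b : bool) :
  (range above).-sigma.-measurable [set H | sub_mem H g = b].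
Proof.
have m1 : (range above).-sigma.-measurable [set H | sub_mem H g].
  apply: sub_sigma_algebra; exists [:: g] => //.
  by apply/seteqP; split=> H; rewrite /above /= andbT.
case: b => //; have -> : [set H | sub_mem H g = false] = ~` [set H | sub_mem H g].
  by apply/seteqP; split=> H /= => [->|/negP/negbTE].
exact: measurableC.
Qed.

Lemma measurable_matching (t : seq bool) :
  (range above).-sigma.-measurable (matching t).
Proof.
have -> : matching t = \bigcap_i
    (if (i < size t)%N then [set K | sub_mem K (e i) = nth false t i] else setT).
  apply/seteqP; split=> K /= hK i; last by move=> ti; have := hK i I; rewrite ti.
  by move=> _; case: ifP => // ti; exact: hK.
apply: bigcapT_measurable => i; case: ifP => // _; exact: measurable_above1.
Qed.

(** An open set is the union of the sets [matching t] that it contains; there are countably many of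
    them, each given by finitely many membership conditions. *)
Lemma borel_subgroupsE :
  @measurable _ (borel_subgroups G) = <<s range above >>.
Proof.
apply/seteqP; split.
- apply: smallest_sub; first exact: smallest_sigma_algebra.
  move=> U oU.
  have -> : U = \bigcup_(t : seq bool)
      (if `[< matching t `<=` U >] then matching t else set0).
    apply/seteqP; split=> [H UH|H [t _]]; last by case: asboolP => // tU /tU.
    have [n hn] := open_local oU UH.
    exists (mkseq (fun i => sub_mem H (e i)) n) => //.
    rewrite asboolT => [i|K hK]; first by rewrite size_mkseq => ni; rewrite nth_mkseq.
    by apply: hn => i ni; rewrite hK ?size_mkseq// nth_mkseq.
  apply: (@countable_bigcupT_measurable _ (g_sigma_algebraType (range above))).
    exact: countableP.
  by move=> t; case: ifP => // _; exact: measurable_matching.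
- apply: smallest_sub; first exact: smallest_sigma_algebra.
  move=> _ [s _ <-]; elim: s => [|g s IHs].
    rewrite [above _](_ : _ = setT); first exact: (@measurableT _ (borel_subgroups G)).
    by apply/seteqP; split.
  rewrite [above _](_ : _ = [set H | sub_mem H g] `&` above s); last first.
    by apply/seteqP; split=> H; rewrite /above /= => /andP.
  apply: (@measurableI _ (borel_subgroups G)) => //.
  by apply: sub_sigma_algebra; exact: open_sub_mem.
Qed.

Lemma setI_above : setI_closed (range above).
Proof.
move=> _ _ [s _ <-] [t _ <-]; exists (s ++ t) => //.
by apply/seteqP; split=> H /=; rewrite /above /= all_cat => /andP.
Qed.

Variable R : realType.

Lemma borel_measure_eq (m1 m2 : probability (borel_subgroups G) R) :
  (forall s, m1 (above s) = m2 (above s)) ->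
  forall A, measurable A -> m1 A = m2 A.
Proof.
move=> m12 A mA.
apply: (@measure_unique _ R (borel_subgroups G) (range above) (fun=> setT)) => //.
- exact: borel_subgroupsE.
- exact: setI_above.
- by move=> _; exists [::] => //; apply/seteqP; split.
- by apply/seteqP; split=> // x _; exists 0%N.
- by move=> _ [s _ <-]; exact: m12.
- by move=> k; rewrite /= probability_setT ltry.
Qed.

(** A measure is coded by the rationals strictly above its values on the countably many sets
    [above s]; the rationals separate these finite values, and the values determine the measure. *)
Lemma card_irs_le : continuous_ergodic_irs G R #<= [set: nat -> bool].
Proof.
pose code (f : set (borel_subgroups G) -> \bar R) (n : nat) : bool :=
  if @choice.unpickle (seq nat * rat)%type n is Some (s, q)
  then (f (above (map e s)) < (ratr q)%:E)%E else false.
have code_inj : {in continuous_ergodic_irs G R &, injective code}.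
  move=> _ _ /set_mem[m1 _ <-] /set_mem[m2 _ <-] c12.
  have mab s : measurable (above s : set (borel_subgroups G)).
    by rewrite borel_subgroupsE; apply: sub_sigma_algebra; exists s.
  have E : forall A, measurable A -> m1 A = m2 A.
    apply: borel_measure_eq => s.
    have [t ->] : exists t, s = map e t.
      elim: s => [|g s [t ->]]; first by exists [::].
      by have [i <-] := e_surj g; exists (i :: t).
    have lt12 q : (m1 (above (map e t)) < (ratr q)%:E)%E =
        (m2 (above (map e t)) < (ratr q)%:E)%E.
      have := congr1 (fun c => c (choice.pickle (t, q))) c12.
      by rewrite /code choice.pickleK /= !patchE !mem_set.
    have f1 := fin_num_measure m1 _ (mab (map e t)).
    have f2 := fin_num_measure m2 _ (mab (map e t)).
    move: lt12; rewrite -(fineK f1) -(fineK f2).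
    move: (fine _) (fine _) => r1 r2 lt12.
    congr (_%:E); apply/eqP; rewrite eq_le.
    apply/andP; split; rewrite leNgt; apply/negP => r12.
      have [q] := rat_in_itvoo r12; rewrite in_itv/= => /andP[q1 q2].
      by have := lt12 q; rewrite !lte_fin q1 ltNge (ltW q2).
    have [q] := rat_in_itvoo r12; rewrite in_itv/= => /andP[q1 q2].
    by have := lt12 q; rewrite !lte_fin q1 ltNge (ltW q2).
  by apply/funext => A; rewrite !patchE; case: ifPn => // /set_mem/E.
have /card_eqPle[_ h] := inj_card_eq code_inj.
exact: card_le_trans h (card_leT _).
Qed.
End BorelSubgroups.

(** * The uniform measure on the boundary of the tree *)

Definition cyl (v : vertex) : set (nat -> bool) := [set x | mkseq x (size v) = v].

(** The empty set is included so that incompatible cylinders also have their intersection in the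
    family. *)
Definition cyls : set (set (nat -> bool)) :=
  [set A | A = set0 \/ exists v, A = cyl v].

Definition cantor := g_sigma_algebraType cyls.
HB.instance Definition _ := Measurable.on cantor.

Lemma take_mkseq (x : nat -> bool) m n : (m <= n)%N ->
  take m (mkseq x n) = mkseq x m.
Proof. by move=> mn; rewrite /mkseq -map_take take_iota (minn_idPl mn). Qed.

Lemma mkseq_cons (x : nat -> bool) n :
  mkseq x n.+1 = x 0%N :: mkseq (x \o S) n.
Proof. by rewrite /mkseq /= -[1%N]addn0 iotaDl -map_comp. Qed.

Lemma setI_cyls : setI_closed cyls.
Proof.
have cylI u v : (size u <= size v)%N -> cyls (cyl u `&` cyl v).
  move=> uv; have [vu|vu] := eqVneq (take (size u) v) u.
    right; exists v; apply/setIidPr => x /= xv.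
    by rewrite /cyl /= -vu -{2}xv take_mkseq ?vu.
  left; apply/seteqP; split=> // x [xu xv].
  by case/eqP: vu; rewrite -[in LHS]xv take_mkseq.
move=> A B [->|[u ->]]; first by rewrite set0I; left.
move=> [->|[v ->]]; first by rewrite setI0; left.
by case: (leqP (size u) (size v)) => [/cylI//|/ltnW/cylI]; rewrite setIC.
Qed.

Lemma measurable_cyl v : measurable (cyl v : set cantor).
Proof. by apply: sub_sigma_algebra; right; exists v. Qed.

Section Bernoulli.
Variable R : realType.
Local Open Scope ring_scope.

Lemma cantor_measure_eq (m1 m2 : {measure set cantor -> \bar R}) :
  (m1 setT < +oo)%E -> (forall v, m1 (cyl v) = m2 (cyl v)) ->
  forall A, measurable A -> m1 A = m2 A.
Proof.
move=> m1T m12 A mA.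
apply: (@measure_unique _ R cantor cyls (fun=> setT)) => //.
- exact: setI_cyls.
- by move=> _; right; exists [::]; apply/seteqP; split.
- by apply/seteqP; split=> // x _; exists 0%N.
- by move=> _ [->|[v ->]]; [rewrite !measure0|exact: m12].
Qed.

(** Binary digits, read by iterating the doubling map on [0, 1). *)
Fixpoint digit (n : nat) (t : R) : bool :=
  if n is n'.+1 then digit n' (if 1 / 2 <= t then 2 * t - 1 else 2 * t)
  else 1 / 2 <= t.

(** The number 0.v in base 2, the left end of the interval of the numbers whose expansion starts
    with [v]. *)
Fixpoint dyadic (v : vertex) : R :=
  if v is x :: v' then ((if x then 1 else 0) + dyadic v') / 2 else 0.

Lemma dyadic_bounds v : 0 <= dyadic v /\ dyadic v + (1 / 2) ^+ size v <= 1.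
Proof.
elim: v => [|x v [h1 h2]] /=; first by rewrite expr0; lra.
by rewrite exprS; case: x; lra.
Qed.

Lemma digitP v t : 0 <= t < 1 ->
  mkseq (digit^~ t) (size v) = v <-> dyadic v <= t < dyadic v + (1 / 2) ^+ size v.
Proof.
elim: v t => [|x v IHv] t t01; first by rewrite expr0 add0r.
have -> : mkseq (digit^~ t) (size (x :: v)) = (1 / 2 <= t) ::
    mkseq (digit^~ (if 1 / 2 <= t then 2 * t - 1 else 2 * t)) (size v).
  exact: mkseq_cons.
set t' := (if _ then _ else _).
have t'01 : 0 <= t' < 1.
  by rewrite /t'; case: (leP (1 / 2) t) => ?; apply/andP; split; lra.
have [b1 b2] := dyadic_bounds v.
rewrite /= exprS; split=> [[xt /(IHv _ t'01)]|h].
  by rewrite /t' xt; move: xt; case: x; case: (leP (1 / 2) t) => // ht _ /andP[h1 h2];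
    apply/andP; split; lra.
have xt : (1 / 2 <= t) = x.
  move: h; case: x => /andP[h1 h2]; first lra.
  by apply/negbTE; rewrite -ltNge; lra.
congr cons => //; apply/(IHv _ t'01); rewrite /t' xt.
by move: h {t' t'01 xt}; case: x => /andP[h1 h2]; apply/andP; split; lra.
Qed.

Let unit_itv : set R := `[0, 1[%classic.

(** The constant ray is a measurable default off [0, 1), a null set for the measure [unit_lebesgue]
    used below. *)
Definition digits (t : R) : nat -> bool :=
  if t \in unit_itv then digit^~ t else fun=> false.

Lemma digits_cyl v : digits @^-1` cyl v `&` unit_itv =
  `[dyadic v, dyadic v + (1 / 2) ^+ size v[%classic.
Proof.
have [b1 b2] := dyadic_bounds v.
apply/seteqP; split=> t /=.
  rewrite /digits => -[+ t01]; rewrite mem_set// => /digitP; rewrite in_itv/=.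
  by apply; move: t01; rewrite /unit_itv/= in_itv.
rewrite in_itv /= => h.
have t01 : 0 <= t < 1 by apply/andP; split; lra.
split; last by rewrite /unit_itv/= in_itv.
rewrite /digits /= mem_set; last by rewrite /unit_itv/= in_itv.
by apply/digitP.
Qed.

Lemma measurable_digits : measurable_fun [set: measurableTypeR R]
  (digits : measurableTypeR R -> cantor).
Proof.
apply: (@measurability _ _ _ cantor [set: measurableTypeR R]
  (digits : measurableTypeR R -> cantor) cyls) => // _ [B [->|[v ->]] <-].
  by rewrite preimage_set0 setI0.
rewrite setTI -[X in measurable X]setIT -(setUv unit_itv) setIUr digits_cyl.
apply: measurableU => //.
(* Off [0, 1) the map is constant, so the preimage there is everything or nothing. *)
have [v0|v0] := pselect (cyl v (fun=> false)).
  rewrite [X in measurable X](_ : _ = ~` unit_itv).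
    by apply: measurableC; exact: measurable_itv.
  apply/seteqP; split=> t /=; first by case.
  by move=> ht; split=> //; rewrite /digits memNset.
rewrite [X in measurable X](_ : _ = set0)//.
by apply/seteqP; split=> t //= [+ ht]; rewrite /digits memNset.
Qed.

Let unit_lebesgue := mrestr (@lebesgue_measure R)
  (measurable_itv `[0, 1[ : measurable unit_itv).

Let unit_lebesgueT : unit_lebesgue setT = 1%E.
Proof.
by rewrite /unit_lebesgue /mrestr setTI lebesgue_measure_itv/= lte_fin ltr01 oppr0 adde0.
Qed.

HB.instance Definition _ := Measure.on unit_lebesgue.
HB.instance Definition _ :=
  Measure_isProbability.Build _ _ _ unit_lebesgue unit_lebesgueT.

HB.instance Definition _ :=
  isMeasurableFun.Build _ _ _ _ (digits : measurableTypeR R -> cantor)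
    measurable_digits.

Definition coin_measure : probability cantor R :=
  distribution unit_lebesgue (digits : {mfun measurableTypeR R >-> cantor}).

Lemma coin_measure_cyl v : coin_measure (cyl v) = ((1 / 2) ^+ size v)%:E.
Proof.
rewrite /coin_measure /distribution /pushforward /= /unit_lebesgue /mrestr digits_cyl.
rewrite lebesgue_measure_itv/= lte_fin ltrDl exprn_gt0; last lra.
by rewrite -EFinB addrAC subrr add0r.
Qed.

End Bernoulli.

(** * Random subgroups fixing the subtrees that leave a ray at given levels *)

Lemma eq_mkseq (x y : nat -> bool) : (forall n, mkseq x n = mkseq y n) -> x = y.
Proof.
move=> xy; apply/funext => n; have := congr1 (nth false ^~ n) (xy n.+1).
by rewrite !nth_mkseq.
Qed.

(* The vertex at which a ray leaves x at level n. *)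
Definition hang (x : nat -> bool) (n : nat) : vertex := rcons (mkseq x n) (~~ x n).

Lemma size_hang x n : size (hang x n) = n.+1.
Proof. by rewrite size_rcons size_mkseq. Qed.

Lemma nth_hang x n i : (i < n)%N -> nth false (hang x n) i = x i.
Proof. by move=> i_n; rewrite nth_rcons size_mkseq i_n nth_mkseq. Qed.

Lemma nth_hang_last x n : nth false (hang x n) n = ~~ x n.
Proof. by rewrite nth_rcons size_mkseq ltnn eqxx. Qed.

Lemma nth_prefix (v w : vertex) i : prefix v w -> (i < size v)%N ->
  nth false w i = nth false v i.
Proof. by case/prefixP => u -> iv; rewrite nth_cat iv. Qed.

(** Of two such vertices, the one leaving at the smaller level disagrees with [x] there, while the
    other still agrees. *)
Lemma hang_disjoint x m n w : prefix (hang x m) w -> prefix (hang x n) w -> m = n.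
Proof.
have h i j : (i < j)%N -> prefix (hang x i) w -> prefix (hang x j) w -> False.
  move=> ij pi pj.
  have := nth_prefix (i := i) pi; rewrite size_hang => /(_ (ltnSn _)).
  rewrite (nth_prefix (i := i) pj) ?size_hang ?ltnS ?(ltnW ij)//.
  by rewrite nth_hang// nth_hang_last; case: (x i).
by move=> pm pn; case: (ltngtP m n) => // /h; [move/(_ pm pn)|move/(_ pn pm)].
Qed.

Lemma prefix_mkseq_hang x m n : (m <= n)%N -> prefix (mkseq x m) (hang x n).
Proof.
move=> mn; apply: (@prefix_trans _ (mkseq x n)); last exact: prefix_rcons.
by rewrite prefixE size_mkseq take_mkseq.
Qed.

Lemma mkseq_or_hang x v : v = mkseq x (size v) \/
  exists2 m, (m < size v)%N & prefix (hang x m) v.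
Proof.
elim/last_ind: v => [|v b [vx|[m mv pm]]]; first by left.
  have [->|bx] := eqVneq b (x (size v)).
    by left; rewrite size_rcons mkseqS -vx.
  right; exists (size v); rewrite ?size_rcons//.
  by rewrite /hang -vx (_ : ~~ x _ = b) ?prefix_refl//; case: b (x _) bx => [] [].
right; exists m; first by rewrite size_rcons ltnS ltnW.
exact: prefix_trans pm (prefix_rcons _ _).
Qed.

Lemma measurable_level (P : vertex -> Prop) n :
  measurable ([set x | P (mkseq x n)] : set cantor).
Proof.
rewrite [X in measurable X](_ : _ = \bigcup_(v in [set v | size v = n /\ P v]) cyl v).
  rewrite bigcup_mkcond; apply: countable_bigcupT_measurable.
    exact: countableP.
  by move=> v; case: ifP => // _; exact: measurable_cyl.
apply/seteqP; split=> x /=; last by case=> v [<- Pv] xv; rewrite xv.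
by move=> Px; exists (mkseq x n); rewrite /cyl/= size_mkseq.
Qed.

(** * Countable groups acting transitively on levels, with nontrivial rigid stabilisers *)

Section TreeAction.
Variables (G : groupType) (e : nat -> G) (act : G -> vertex -> vertex).
Hypothesis e_surj : forall g, exists n, e n = g.
Hypothesis act1 : forall v, act 1 v = v.
Hypothesis actM : forall g h v, act (g * h) v = act g (act h v).
Hypothesis act_take : forall g n v, take n (act g v) = act g (take n v).
Hypothesis size_act : forall g v, size (act g v) = size v.
Hypothesis act_trans : forall u v, size u = size v -> exists g, act g u = v.
Hypothesis act_rist : forall v, exists g u, act g (v ++ u) <> v ++ u /\
  forall w, ~~ prefix v w -> act g w = w.

Lemma actK g : cancel (act g) (act g^-1).
Proof. by move=> v; rewrite -actM mulVg act1. Qed.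

Lemma actVK g : cancel (act g^-1) (act g).
Proof. by move=> v; rewrite -actM mulgV act1. Qed.

Definition ray_act (g : G) (x : nat -> bool) : nat -> bool :=
  fun n => nth false (act g (mkseq x n.+1)) n.

Lemma mkseq_ray_act g x n : mkseq (ray_act g x) n = act g (mkseq x n).
Proof.
apply: (@eq_from_nth _ false) => [|i]; first by rewrite size_act !size_mkseq.
rewrite size_mkseq => i_n; rewrite nth_mkseq// /ray_act.
by rewrite -(take_mkseq x i_n) -act_take nth_take.
Qed.

Lemma ray_actM g h x : ray_act (g * h) x = ray_act g (ray_act h x).
Proof. by apply: eq_mkseq => n; rewrite !mkseq_ray_act actM. Qed.

Lemma ray_act1 x : ray_act 1 x = x.
Proof. by apply: eq_mkseq => n; rewrite mkseq_ray_act act1. Qed.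

Lemma ray_actK g : cancel (ray_act g) (ray_act g^-1).
Proof. by move=> x; rewrite -ray_actM mulVg ray_act1. Qed.

Lemma ray_act_cyl g v : ray_act g @^-1` cyl v = cyl (act g^-1 v).
Proof.
apply/seteqP; split=> x; rewrite /cyl /= size_act mkseq_ray_act => xv.
  by rewrite -[in RHS]xv actK.
by rewrite xv actVK.
Qed.

(** Being injective and compatible with prefixes, [g] sends the sibling of a vertex of the ray to
    the sibling of its image. *)
Lemma act_hang g x n : act g (hang x n) = hang (ray_act g x) n.
Proof.
have sz : size (act g (hang x n)) = n.+1 by rewrite size_act size_hang.
have tk : take n (act g (hang x n)) = mkseq (ray_act g x) n.
  by rewrite act_take mkseq_ray_act /hang -cats1 take_size_cat ?size_mkseq.
have : act g (hang x n) <> mkseq (ray_act g x) n.+1.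
  rewrite mkseq_ray_act => /(can_inj (actK g)); rewrite mkseqS /hang => /rcons_inj[].
  by case: (x n).
move: sz tk; case/lastP: (act g (hang x n)) => // v b.
rewrite size_rcons => -[vn]; have -> : take n (rcons v b) = v.
  by rewrite -cats1 take_size_cat.
move=> ->; rewrite mkseqS /hang => h; congr rcons; move: h.
by case: b (ray_act g x n) => [] [].
Qed.

Lemma act_hang_cat g x n u : act g (hang x n ++ u) =
  hang (ray_act g x) n ++ drop n.+1 (act g (hang x n ++ u)).
Proof.
rewrite -[LHS](cat_take_drop n.+1) act_take take_cat size_hang ltnn subnn take0.
by rewrite cats0 act_hang.
Qed.

Definition fixes_below (v : vertex) (g : G) : Prop :=
  forall u, act g (v ++ u) = v ++ u.

Lemma fixes_belowP v g :
  fixes_below v g <-> forall w, prefix v w -> act g w = w.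
Proof.
by split=> [h w /prefixP[u ->]//|h u]; apply: h; rewrite prefix_prefix.
Qed.

Section LevelSet.
Variable A : nat -> bool.

Definition hang_fun (x : nat -> bool) : {ptws G -> bool} :=
  fun g => `[< forall n, A n -> fixes_below (hang x n) g >].

Fact hang_closed x :
  [set H : {ptws G -> bool} | group_closed (H : {pred G})] (hang_fun x).
Proof.
split=> [|g h]; rewrite !unfold_in /hang_fun.
  by apply/asboolP => n _ u; rewrite act1.
move=> /asboolP hg /asboolP hh; apply/asboolP => n An u.
by rewrite actM -{1}(hh _ An u) actK hg.
Qed.

Definition hang_stab (x : nat -> bool) : subgroups G := SigSub (mem_set (hang_closed x)).

Lemma mem_hang_stab x g : sub_mem (hang_stab x) g <->
  forall n, A n -> fixes_below (hang x n) g.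
Proof. by split=> [/asboolP//|h]; apply/asboolP. Qed.

(** One inclusion follows by moving the hanging subtrees with [g]; the other is the same inclusion
    for the inverse of [g]. *)
Lemma hang_stab_conj g x : hang_stab (ray_act g x) = conj_subgroup g (hang_stab x).
Proof.
have half k y h : sub_mem (hang_stab (ray_act k y)) h -> sub_mem (hang_stab y) (h ^ k).
  move=> /mem_hang_stab hk; apply/mem_hang_stab => n An u.
  by rewrite conjgE !actM act_hang_cat hk// -act_hang_cat actK.
apply: subgroups_eq => h; rewrite [RHS]/(sub_mem (hang_stab x) (h ^ g)).
apply/idP/idP; first exact: half.
by rewrite -{1}(ray_actK g x) => /half; rewrite -conjgM mulgV conjg1.
Qed.

Lemma measurable_hang_stab :
  measurable_fun [set: cantor] (hang_stab : cantor -> borel_subgroups G).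
Proof.
apply: (@measurability _ _ cantor (borel_subgroups G) setT _ (range (@above G))).
  exact: borel_subgroupsE e_surj.
move=> _ [_ [s _ <-] <-]; rewrite setTI; elim: s => [|g s IHs].
  by rewrite [X in measurable X](_ : _ = setT)//; apply/seteqP; split.
rewrite [X in measurable X](_ : _ =
    [set x | sub_mem (hang_stab x) g] `&` (hang_stab @^-1` above s)); last first.
  by apply/seteqP; split=> x; rewrite /above /= => /andP.
apply: measurableI => //.
(* [flip n] recovers [hang x n] from the first n + 1 digits of [x], so membership of [g] is a
   countable conjunction of conditions on finite levels. *)
pose flip n v := rcons (take n v) (~~ nth false v n).
rewrite [X in measurable X](_ : _ = \bigcap_n
    [set x | A n -> fixes_below (flip n (mkseq x n.+1)) g]); last first.
  have fh x n : flip n (mkseq x n.+1) = hang x n.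
    by rewrite /flip take_mkseq// nth_mkseq.
  apply/seteqP; split=> x /=.
    by move=> /mem_hang_stab h n _ An; rewrite fh; exact: h.
  by move=> h; apply/mem_hang_stab => n An; rewrite -fh; exact: h.
apply: bigcapT_measurable => n.
exact: (measurable_level (fun v => A n -> fixes_below (flip n v) g)).
Qed.

Hypothesis A_inf : forall m, exists2 n, (m <= n)%N & A n.
Hypothesis A_coinf : forall m, exists2 n, (m <= n)%N & ~~ A n.

(** Subtrees hanging off the ray at different levels are disjoint, so an element supported in the
    one at a level outside [A] fixes all those at levels in [A]. *)
Lemma rist_in_hang_stab x v m g : ~~ A m -> prefix (hang x m) v ->
  (forall w, ~~ prefix v w -> act g w = w) -> sub_mem (hang_stab x) g.
Proof.
move=> Am xv gv; apply/mem_hang_stab => n An u; apply: gv; apply/negP => vw.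
have := hang_disjoint (prefix_trans xv vw) (prefix_prefix _ _).
by move=> mn; rewrite mn An in Am.
Qed.

(** At the first level m where the rays differ, each ray enters the subtree hanging off the other
    one. If m is in [A], a rigid element hanging off y at a later level outside [A] lies in the
    group of y, but moves a vertex in a subtree that the group of x fixes. Otherwise a rigid element
    hanging off x at a later level in [A] lies in the group of y and not in that of x. *)
Lemma hang_stab_inj : injective hang_stab.
Proof.
move=> x y xy; apply: contrapT => nxy.
have [m mxy mdiff] : exists2 m, mkseq x m = mkseq y m & x m != y m.
  have h : exists m, x m != y m.
    apply: contrapT => hn; apply: nxy; apply/funext => m.
    by apply: contrapT => /eqP xm; apply: hn; exists m.
  case: (ex_minnP h) => m xm min; exists m => //.
  apply: (@eq_from_nth _ false) => [|i]; first by rewrite !size_mkseq.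
  rewrite size_mkseq => im; rewrite !nth_mkseq//; apply/eqP/negPn/negP => /min.
  by rewrite leqNgt im.
have hx : hang x m = mkseq y m.+1.
  by rewrite mkseqS -mxy /hang; case: (x m) (y m) mdiff => [] [].
have hy : hang y m = mkseq x m.+1.
  by rewrite mkseqS mxy /hang; case: (x m) (y m) mdiff => [] [].
case: (boolP (A m)) => Am.
  have [n mn An] := A_coinf m.+1.
  have [g [u [gu gv]]] := act_rist (hang y n).
  have := rist_in_hang_stab An (prefix_refl _) gv.
  rewrite -xy => /mem_hang_stab/(_ _ Am)/fixes_belowP h; apply: gu; apply: h.
  rewrite hx; apply: prefix_trans (prefix_prefix _ _); exact: prefix_mkseq_hang.
have [n mn An] := A_inf m.+1.
have [g [u [gu gv]]] := act_rist (hang x n).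
have hyx : prefix (hang y m) (hang x n) by rewrite hy prefix_mkseq_hang.
have := rist_in_hang_stab Am hyx gv.
by rewrite -xy => /mem_hang_stab/(_ _ An u).
Qed.

(** The subtrees fixed by the whole subgroup are what makes [A] visible to a measure. In the
    remaining cases a rigid element of the subgroup moves something below [v]: it hangs off a later
    level outside [A] if [v] is on the ray, and is taken at [v] itself if [v] has left the ray at a
    level outside [A]. *)
Lemma hang_stab_fixes_below x v :
  (forall g, sub_mem (hang_stab x) g -> fixes_below v g) <->
  exists2 m, (m < size v)%N & A m /\ prefix (hang x m) v.
Proof.
split=> [h|[m mv [Am xv]] g /mem_hang_stab/(_ _ Am)/fixes_belowP gx]; last first.
  by apply/fixes_belowP => w vw; apply: gx; exact: prefix_trans vw.
have [vx|[m mv xv]] := mkseq_or_hang x v.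
  have [n vn An] := A_coinf (size v).
  have [g [u [gu gv]]] := act_rist (hang x n).
  have /h/fixes_belowP gfix := rist_in_hang_stab An (prefix_refl _) gv.
  case: gu; apply: gfix; rewrite vx; apply: prefix_trans (prefix_prefix _ _).
  exact: prefix_mkseq_hang.
case: (boolP (A m)) => Am; first by exists m.
have [g [u [gu gv]]] := act_rist v.
by have /h/(_ u) := rist_in_hang_stab Am xv gv.
Qed.

End LevelSet.

Variable R : realType.

Let mu := coin_measure R.

Lemma measurable_ray_act g : measurable_fun [set: cantor] (ray_act g : cantor -> cantor).
Proof.
apply: (@measurability _ _ cantor cantor setT _ cyls) => // _ [B [->|[v ->]] <-].
  by rewrite preimage_set0 setI0.
rewrite setTI ray_act_cyl; exact: measurable_cyl.
Qed.

HB.instance Definition _ g :=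
  isMeasurableFun.Build _ _ _ _ (ray_act g : cantor -> cantor) (measurable_ray_act g).

(** Two measures in [B] are compared on cylinders, and [g] permutes the cylinders of each length. *)
Lemma coin_measure_ray_act g (B : set cantor) : measurable B ->
  mu (ray_act g @^-1` B) = mu B.
Proof.
move=> mB; have := @cantor_measure_eq R
  (distribution mu (ray_act g : {mfun cantor >-> cantor})) mu _ _ B mB.
apply.
  by rewrite /= /distribution /pushforward preimage_setT probability_setT ltry.
move=> v; rewrite -[LHS]/(mu (ray_act g @^-1` cyl v)) ray_act_cyl.
rewrite coin_measure_cyl size_act; exact/esym/coin_measure_cyl.
Qed.

Lemma cylS v : cyl v = cyl (rcons v false) `|` cyl (rcons v true).
Proof.
apply/seteqP; split=> x; rewrite /cyl /= !size_rcons !mkseqS.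
  by move=> ->; case: (x (size v)); [right|left].
by case=> /rcons_inj[].
Qed.

(* An invariant set meets all cylinders of a level in the same measure, so it
   is independent of every cylinder, hence of itself. *)
Lemma coin_measure_ergodic (E : set cantor) : measurable E ->
  (forall g, ray_act g @^-1` E = E) -> mu E = 0%E \/ mu E = 1%E.
Proof.
move=> mE invE.
have mcE v : measurable (cyl v `&` E : set cantor).
  by apply: measurableI => //; exact: measurable_cyl.
have cylE u v : size u = size v -> mu (cyl u `&` E) = mu (cyl v `&` E).
  move=> /act_trans[g guv].
  rewrite -(coin_measure_ray_act g (mcE v)) preimage_setI invE ray_act_cyl.
  by rewrite -guv actK.
have mu_fin (B : set cantor) : measurable B -> mu B \is a fin_num.
  exact: fin_num_measure.
pose c := fine (mu E).
have cE : mu E = c%:E by rewrite fineK ?mu_fin.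
have cyl_c v : mu (cyl v `&` E) = ((1 / 2) ^+ size v * c)%R%:E.
  elim/last_ind: v => [|v b IHv].
    rewrite expr0 mul1r -cE; congr (mu _).
    by rewrite (_ : cyl [::] = setT) ?setTI//; apply/seteqP; split.
  have sp : mu (cyl v `&` E) =
      (mu (cyl (rcons v false) `&` E) + mu (cyl (rcons v true) `&` E))%E.
    rewrite [in LHS]cylS setIUl; apply: measureU => //.
    apply/seteqP; split=> // x [[+ _] [+ _]]; rewrite /cyl/= !size_rcons => -> .
    by move=> /rcons_inj[].
  move: IHv; rewrite sp (cylE (rcons v false) (rcons v b)) ?size_rcons//.
  rewrite (cylE (rcons v true) (rcons v b)) ?size_rcons//.
  rewrite -(fineK (mu_fin _ (mcE (rcons v b)))) -EFinD => -[h].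
  by congr (_%:E); rewrite exprS; lra.
have c0 : (0 <= c)%R by rewrite -lee_fin -cE.
have h : mrestr mu mE E = mscale (NngNum c0) mu E.
  apply: cantor_measure_eq => //=.
    by rewrite /mrestr setTI; apply: le_lt_trans (ltry c); rewrite -cE.
  move=> v; rewrite /mrestr /mscale /= -[LHS]/(mu (cyl v `&` E)) cyl_c.
  by rewrite mulrC EFinM; congr (_ * _)%E; exact/esym/coin_measure_cyl.
have {h} : c = (c * c)%R.
  have : mu (E `&` E) = (c%:E * mu E)%E := h.
  by rewrite setIid cE -EFinM => -[].
have [c_eq0 _|c_neq0 cc] := eqVneq c 0%R; first by left; rewrite -/mu cE c_eq0.
by right; rewrite -/mu cE; congr (_%:E); apply: (mulfI c_neq0); rewrite mulr1.
Qed.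

Lemma coin_measure_set1 (x : cantor) : mu [set x] = 0%E.
Proof.
have set1E : [set x] = \bigcap_n cyl (mkseq x n).
  apply/seteqP; split=> y /=; first by move=> -> n _; rewrite /cyl/= size_mkseq.
  by move=> h; apply: eq_mkseq => n; have := h n I; rewrite /cyl/= size_mkseq.
have mx : measurable [set x].
  by rewrite set1E; apply: bigcapT_measurable => n; exact: measurable_cyl.
have small n : (mu [set x] <= ((1 / 2) ^+ n)%R%:E)%E.
  rewrite -[X in (_ ^+ X)%R](size_mkseq x n) -coin_measure_cyl.
  apply: le_measure; rewrite ?inE//; first exact: measurable_cyl.
  by move=> _ ->; rewrite /cyl/= size_mkseq.
have xfin : mu [set x] \is a fin_num by exact: fin_num_measure.
apply/eqP; rewrite eq_le measure_ge0 andbT -(fineK xfin) lee_fin leNgt.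
apply/negP => r0; have := @cvg_expr R (1 / 2) _; rewrite ger0_norm; last lra.
move=> /(_ ltac:(lra)) /cvgrPdist_lt /(_ _ r0)[n _ /(_ n (leqnn n))] /=.
rewrite sub0r normrN ger0_norm; last by apply: exprn_ge0; lra.
by have := small n; rewrite -(fineK xfin) lee_fin leNgt => /negP.
Qed.

HB.instance Definition _ (A : nat -> bool) :=
  isMeasurableFun.Build _ _ _ _ (hang_stab A : cantor -> borel_subgroups G)
    (measurable_hang_stab A).

Definition hang_irs (A : nat -> bool) : probability (borel_subgroups G) R :=
  distribution mu (hang_stab A : {mfun cantor >-> borel_subgroups G}).

Lemma hang_irsE A B : hang_irs A B = mu (hang_stab A @^-1` B).
Proof. by []. Qed.

Lemma measurable_hang_preimage A (B : set (borel_subgroups G)) : measurable B ->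
  measurable (hang_stab A @^-1` B : set cantor).
Proof. by move=> mB; rewrite -[X in measurable X]setTI; exact: measurable_hang_stab. Qed.

Lemma hang_conj_preimage A g (B : set (borel_subgroups G)) :
  hang_stab A @^-1` (conj_subgroup g @^-1` B) =
  ray_act g @^-1` (hang_stab A @^-1` B).
Proof. by apply/seteqP; split=> x /=; rewrite hang_stab_conj. Qed.

Lemma invariant_hang_irs A : invariant_random_subgroup (hang_irs A).
Proof.
move=> g B mB; rewrite !hang_irsE hang_conj_preimage coin_measure_ray_act//.
exact: measurable_hang_preimage.
Qed.

Lemma ergodic_hang_irs A : ergodic (hang_irs A).
Proof.
move=> B mB invB; rewrite !hang_irsE; apply: coin_measure_ergodic.
  exact: measurable_hang_preimage.
by move=> g; rewrite -hang_conj_preimage invB.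
Qed.

Lemma continuous_hang_irs (A : nat -> bool) :
  (forall m, exists2 n, (m <= n)%N & A n) ->
  (forall m, exists2 n, (m <= n)%N & ~~ A n) ->
  continuous_measure (hang_irs A).
Proof.
move=> Ainf Acoinf H; rewrite hang_irsE.
have [[x xH]|nx] := pselect (exists x, hang_stab A x = H).
  rewrite (_ : _ @^-1` _ = [set x]) ?coin_measure_set1//.
  apply/seteqP; split=> y /=; last by move=> ->.
  by rewrite -xH => /(hang_stab_inj Ainf Acoinf).
rewrite (_ : _ @^-1` _ = set0) ?measure0//.
by apply/seteqP; split=> // y yH; apply: nx; exists y.
Qed.

Definition below (v : vertex) : set (borel_subgroups G) :=
  [set H | forall g, sub_mem H g -> fixes_below v g].

(** Of the countably many group elements, exactly those that do not fix the subtree must be absent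
    from the subgroup. *)
Lemma measurable_below v : measurable (below v).
Proof.
rewrite [X in measurable X](_ : _ = \bigcap_n
   (if `[< fixes_below v (e n) >] then setT else ~` above [:: e n])); last first.
  apply/seteqP; split=> H /= h.
    move=> n _; case: asboolP => // hn; rewrite /above /= andbT.
    by move/h.
  move=> g; have [n <-] := e_surj g; have := h n I; case: asboolP => // _.
  by rewrite /above /= andbT.
apply: bigcapT_measurable => n; case: ifP => // _; apply: measurableC.
by rewrite (borel_subgroupsE e_surj); apply: sub_sigma_algebra; exists [:: e n].
Qed.

(* Only the rays leaving the all-0 ray exactly at level n, and only when n is
   in A, give subgroups in this set. *)
Lemma hang_irs_separates (A : nat -> bool) n :
  (forall m, exists2 k, (m <= k)%N & ~~ A k) ->
  hang_irs A (below (nseq n.+1 false) `\` below (nseq n false)) =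
  if A n then ((1 / 2) ^+ n.+1)%R%:E else 0%E.
Proof.
move=> Acoinf.
have nseqS : nseq n.+1 false = rcons (nseq n false) false.
  by rewrite -[n.+1]addn1 nseqD cats1.
rewrite hang_irsE (_ : _ @^-1` _ =
    if A n then cyl (rcons (nseq n false) true) else set0).
  by case: (A n); rewrite ?measure0// coin_measure_cyl size_rcons size_nseq.
have hangE x : prefix (hang x n) (nseq n.+1 false) ->
    cyl (rcons (nseq n false) true) x.
  rewrite prefixE size_hang take_oversize ?size_nseq// nseqS => /eqP/rcons_inj[h1 h2].
  by rewrite /cyl /= size_rcons size_nseq mkseqS -h1; case: (x n) h2.
apply/seteqP; split=> x.
  case=> /(hang_stab_fixes_below Acoinf)[m mn [Am xm]] h.
  have mnE : m = n.
    apply/eqP; rewrite eqn_leq; rewrite size_nseq ltnS in mn; rewrite mn /=.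
    rewrite leqNgt; apply/negP => mltn; apply: h.
    apply/(hang_stab_fixes_below Acoinf); exists m; rewrite ?size_nseq//; split=> //.
    move: xm; rewrite prefixE size_hang nseqS -cats1 take_cat size_nseq.
    move: mltn; rewrite leq_eqVlt => /orP[/eqP ->|->].
      by rewrite ltnn subnn take0 cats0 => /eqP <-; exact: prefix_refl.
    by rewrite prefixE size_hang.
  by move: xm; rewrite -mnE Am mnE; exact: hangE.
case: ifP => // An xn.
have xE : hang x n = nseq n.+1 false.
  move: xn; rewrite /cyl /mkset size_rcons size_nseq mkseqS => /rcons_inj[h1 h2].
  by rewrite nseqS /hang h1 h2.
split.
  apply/(hang_stab_fixes_below Acoinf); exists n; rewrite ?size_nseq// -xE.
  by split=> //; exact: prefix_refl.
move=> /(hang_stab_fixes_below Acoinf)[m]; rewrite size_nseq => mn [_ xm].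
have xm' : prefix (hang x m) (hang x n).
  by rewrite xE nseqS; apply: prefix_trans xm (prefix_rcons _ _).
by move: mn; rewrite (hang_disjoint xm' (prefix_refl _)) ltnn.
Qed.

(* Residues 0 and 2 make this set of levels infinite and coinfinite, whatever
   the set B encoded in the residue 1. *)
Definition levels (B : nat -> bool) (n : nat) : bool :=
  match (n %% 3)%N with 0%N => true | 1%N => B (n %/ 3)%N | _ => false end.

Lemma levels_inf B m : exists2 n, (m <= n)%N & levels B n.
Proof. by exists (m * 3)%N; rewrite ?leq_pmulr// /levels modnMl. Qed.

Lemma levels_coinf B m : exists2 n, (m <= n)%N & ~~ levels B n.
Proof.
exists (m * 3 + 2)%N; last by rewrite /levels modnMDl.
by rewrite (leq_trans _ (leq_addr _ _))// leq_pmulr.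
Qed.

Lemma levels_mod1 B m : levels B (m * 3 + 1) = B m.
Proof. by rewrite /levels modnMDl /= divnMDl// addn0. Qed.

(** Cantor-Bernstein. For the lower bound, the bit m of [B] is recovered at level n = 3m + 1, where
    a fixed Borel set has measure 2^-(n+1) or 0 according to that bit. *)
Lemma card_irs : continuous_ergodic_irs G R #= [set: nat -> bool].
Proof.
apply/card_eqPle; split; first exact: card_irs_le e_surj R.
pose F (B : nat -> bool) : set (borel_subgroups G) -> \bar R :=
  (hang_irs (levels B) : set (borel_subgroups G) -> \bar R) \_ measurable.
have F_inj : {in [set: nat -> bool] &, injective F}.
  move=> B C _ _ BC; apply/funext => m.
  pose n := (m * 3 + 1)%N.
  have := congr1 (fun f => f (below (nseq n.+1 false) `\` below (nseq n false))) BC.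
  rewrite /F !patchE mem_set; last by apply: measurableD; exact: measurable_below.
  rewrite (hang_irs_separates _ (levels_coinf B)) (hang_irs_separates _ (levels_coinf C)).
  have : (0 < (1 / 2) ^+ n.+1 :> R)%R by apply: exprn_gt0; lra.
  rewrite !levels_mod1; case: (B m) (C m) => [] [] // p0 [h].
    by rewrite h ltxx in p0.
  by rewrite -h ltxx in p0.
have /card_eqPle[_ h] := inj_card_eq F_inj.
apply: card_le_trans h _; apply: subset_card_le => _ [B _ <-].
exists (hang_irs (levels B)) => //; split.
- exact: invariant_hang_irs.
- exact: continuous_hang_irs (levels_inf B) (levels_coinf B).
- exact: ergodic_hang_irs.
Qed.
End TreeAction.

(** * Transitivity and rigid stabilisers *)

Lemma word_act_revK w : cancel (word_act (rev w)) (word_act w).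
Proof. by move=> v; rewrite -{1}(revK w) word_act_rev. Qed.

Lemma gact_trans u v : size u = size v -> exists g, gact g u = v.
Proof.
move=> uv; have [c cu] := word_transitive u; have [d dv] := word_transitive v.
exists (gword (rev d ++ c)).
by rewrite gact_gword word_act_cat cu uv -dv word_act_rev.
Qed.

(** The element supported below 1^n is conjugated by one that moves [v] to 1^n. *)
Lemma gact_rist v : exists g u, gact g (v ++ u) <> v ++ u /\
  forall w, ~~ prefix v w -> gact g w = w.
Proof.
have [c cv] := word_transitive v; set n := size v in cv.
pose r := iter n sigma tword.
(* The moved vertex is pulled back from 1^n 00, since abab sends 00 to 01. *)
pose z := word_act (rev c) (nseq n true ++ [:: false; false]).
exists (gword (rev c ++ r ++ c)), (drop n z).
have zE : v ++ drop n z = z.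
  rewrite -[RHS](cat_take_drop n); congr cat.
  by rewrite /z word_act_take take_size_cat ?size_nseq// -cv word_act_rev.
rewrite zE gact_gword; split=> [|w vw]; rewrite !word_act_cat.
  rewrite {1}/z word_act_revK /r iter_sigma_in => h.
  have /(congr1 (word_act c)) := h; rewrite /z !word_act_revK.
  by move=> /(congr1 (drop n)); rewrite !drop_size_cat ?size_nseq.
rewrite /r iter_sigma_out ?word_act_rev//.
apply: contra vw => /prefixP[u cw].
have := word_act_take c n w; rewrite cw take_size_cat ?size_nseq// -cv.
by move=> /(can_inj (word_act_rev c)) vE; rewrite prefixE -/n -vE.
Qed.

Definition genum (n : nat) : G0 :=
  gword [seq idx_gen i | i <- odflt [::] (@choice.unpickle (seq 'I_4) n)].

Lemma genum_surj g : exists n, genum n = g.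
Proof.
have [w <-] := gword_surj g; exists (choice.pickle [seq gen_idx l | l <- w]).
by rewrite /genum choice.pickleK /= mapK//; exact: gen_idxK.
Qed.

Lemma gact_take g n v : take n (gact g v) = gact g (take n v).
Proof. by have [w <-] := gword_surj g; rewrite gact_gword word_act_take. Qed.

Lemma size_gact g v : size (gact g v) = size v.
Proof. by have [w <-] := gword_surj g; rewrite gact_gword size_word_act. Qed.

Local Close Scope group_scope.

Theorem mainTheorem1 (R : realType) :
  exists Lambda : set Omega,
    [/\ Lambda !=set0,
        intermediate_growth R (U_gen Lambda) &
        continuous_ergodic_irs (U_ Lambda) R #= [set: nat -> bool]].
Proof.
exists Lambda0; split; first by exists omega0.
- exact: intermediate0.
- apply: (@card_irs G0 genum gact genum_surj _ _ gact_take size_gact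
    gact_trans gact_rist).
  + by move=> v; rewrite gact1.
  + by move=> g h v; rewrite gactM.
Qed.
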